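(* Let $X$ be an arbitrary topological space and let $\mathcal A\colon X\to\mathcal R_K^{\mathrm{sa}}(H)$ be a Riesz continuous map. Suppose that $\mathcal A$ admits an $r$-spectral section $P$. Then $\mathcal A$ admits an $r$-trivializing family $\mathcal C\colon X\to\mathcal B^{\mathrm{sa}}(H)$ that agrees with $P$ and satisfies $\|\mathcal C_x\|<2r_x$ for every $x\in X$.
   Context: $H$ is a separable complex Hilbert space of infinite dimension. $\mathcal R_K^{\mathrm{sa}}(H)$ is the set of regular (closed densely defined) self-adjoint operators $A$ on $H$ with compact resolvents, i.e. with $(A+i)^{-1}$ compact. The bounded transform is $f(A)=A(1+A^*A)^{-1/2}$; the Riesz topology is the topology induced by $f$ from the norm topology on $\mathcal B(H)$; Riesz continuous means continuous with respect to it. $\mathcal B^{\mathrm{sa}}(H)$ is the space of bounded self-adjoint operators with the norm topology. Projection means orthogonal projection. $\mathbb 1_S$ is the characteristic function of $S\subset\mathbb R$; $\mathbb R_+=(0,\infty)$. For a number $r>0$, a projection $P$ is an $r$-spectral section for an operator $A$ if $\mathbb 1_{[r,+\infty)}(A)\le P\le\mathbb 1_{(-r,+\infty)}(A)$. For a continuous function $r\colon X\to\mathbb R_+$, an $r$-spectral section for a family $\mathcal A=(\mathcal A_x)_{x\in X}$ is a norm continuous family $P=(P_x)_{x\in X}$ of projections such that $P_x$ is an $r_x$-spectral section for $\mathcal A_x$ for every $x\in X$. A self-adjoint operator $C$ of finite rank is an $r$-trivializing operator for $A\in\mathcal R_K^{\mathrm{sa}}(H)$ if $A+C$ is invertible and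 the range of $C$ lies in the range of $\mathbb 1_{(-r,r)}(A)$. An $r$-trivializing family for $\mathcal A$ ($r\colon X\to\mathbb R_+$ continuous) is a norm continuous family $\mathcal C\colon X\to\mathcal B^{\mathrm{sa}}(H)$ such that $\mathcal C_x$ is an $r_x$-trivializing operator for $\mathcal A_x$ for every $x\in X$. It agrees with $P$ if $P_x=\mathbb 1_{[0,+\infty)}(\mathcal A_x+\mathcal C_x)$ for every $x\in X$. *)

(* Defs.v *)
From HB Require Import structures.
From mathcomp Require Export all_boot all_order all_algebra.
From mathcomp Require Export complex.
From mathcomp Require Export all_classical all_reals all_analysis.

Set Implicit Arguments.
Unset Strict Implicit.
Unset Printing Implicit Defensive.

Import Order.TTheory GRing.Theory Num.Theory.
Import numFieldNormedType.Exports.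

Local Open Scope classical_set_scope.
Local Open Scope ring_scope.

(* Complex Hilbert spaces; the inner product is linear in its first argument
   and conjugate-linear in its second argument. *)
Record hilbertSpace (R : realType) := HilbertSpace {
  carrier :> completeNormedModType R[i];
  inner : {dot carrier for Num.conj};
  inner_norm : forall v : carrier, `|v| ^+ 2 = inner v v }.

Section Operators.
Variables (R : realType) (H : hilbertSpace R).
Implicit Types (T C P Q K B : H -> H) (A : set (H * H)) (V : set H).

Local Notation "'[ u , v ]" := (inner H u v).

Definition separable : Prop :=
  exists2 D : set H, countable D & dense D.

Definition finitely_spanned V : Prop :=
  exists n (e : 'I_n -> H),
    V `<=` [set \sum_(i < n) c i *: e i | c in [set: 'I_n -> R[i]]].

Definition infinite_dimensional : Prop := ~ finitely_spanned [set: H].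

(* Norms take values in R[i]; they are real, so Re only changes the type. *)
Definition rnorm (v : H) : R := complex.Re `|v|.

Definition bounded_operator T : Prop := linear T /\ continuous T.

Definition opnorm T : R :=
  sup [set rnorm (T v) | v in [set v | rnorm v <= 1]].

Definition norm_continuous (X : topologicalType) (F : X -> H -> H) : Prop :=
  forall x (e : R), 0 < e ->
    \forall y \near x, opnorm (fun v => F y v - F x v) < e.

Definition bounded_selfadjoint T : Prop :=
  bounded_operator T /\ forall u v, '[T u, v] = '[u, T v].

Definition nonneg_operator T : Prop := forall v, 0 <= '[T v, v].

Definition le_operator P Q : Prop := nonneg_operator (fun v => Q v - P v).

Definition orthogonal_projection P : Prop :=
  bounded_selfadjoint P /\ forall v, P (P v) = P v.

Definition compact_operator K : Prop :=
  bounded_operator K /\ precompact (K @` [set v | rnorm v <= 1]).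

Definition finite_rank T : Prop := finitely_spanned (range T).

(* A partially defined operator is given by its graph, a subset of H * H. *)

Definition graph T : set (H * H) := [set p | p.2 = T p.1].

Definition dom A : set H := [set v | exists w, A (v, w)].

Definition is_operator A : Prop :=
  [/\ A 0, forall (a : R[i]) p q, A p -> A q -> A (a *: p + q) &
      forall v w w', A (v, w) -> A (v, w') -> w = w'].

Definition regular A : Prop :=
  [/\ is_operator A, closed A & dense (dom A)].

Definition adjoint A : set (H * H) :=
  [set p | forall q, A q -> '[q.2, p.1] = '[q.1, p.2]].

Definition op_comp A' A : set (H * H) :=
  [set p | exists2 u, A (p.1, u) & A' (u, p.2)].

Definition op_inv A : set (H * H) := [set p | A (p.2, p.1)].

(* The sum A + T, where T is defined everywhere. *)
Definition op_add A T : set (H * H) := [set (p.1, p.2 + T p.1) | p in A].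

Definition invertible A : Prop :=
  exists2 T, bounded_operator T & op_inv A = graph T.

Definition compact_resolvents A : Prop :=
  exists2 K, compact_operator K &
    op_inv (op_add A (fun v => 'i%C *: v)) = graph K.

Definition RKsa A : Prop :=
  [/\ regular A, adjoint A = A & compact_resolvents A].

(* T = A (1 + A^* A)^{-1/2}, where B = (1 + A^* A)^{-1/2} is the bounded
   nonnegative square root of (1 + A^* A)^{-1}. *)
Definition is_bounded_transform A T : Prop :=
  exists B, [/\ bounded_operator B, nonneg_operator B,
    op_inv (op_add (op_comp (adjoint A) A) id) = graph (B \o B) &
    op_comp A (graph B) = graph T].

Definition bounded_transform A : H -> H :=
  xget (fun=> 0) [set T | is_bounded_transform A T].

Definition Riesz_continuous (X : topologicalType) (F : X -> set (H * H)) :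
    Prop :=
  norm_continuous (fun x => bounded_transform (F x)).

(* E is the projection-valued Borel measure on the real line such that A is
   the integral of t with respect to dE(t); by polarization it is enough to
   integrate against the scalar measures mu(S) = <E(S) v, v>.  The values of E
   on nonmeasurable sets are irrelevant. *)
Definition is_spectral_measure A (E : set R -> H -> H) : Prop :=
  [/\ forall S, measurable S -> orthogonal_projection (E S),
      E [set: R] = id,
      forall S S', measurable S -> measurable S' ->
        E (S `&` S') = E S \o E S' &
      forall v, exists mu : {measure set R -> \bar R},
        [/\ forall S, measurable S -> mu S = (complex.Re '[E S v, v])%:E,
            dom A v <-> (\int[mu]_t (t ^+ 2)%:E < +oo)%E &
            forall w, A (v, w) -> '[w, v] = (\int[mu]_t t)%:C%C]].

(* The characteristic function of S applied to A, for S a Borel set. *)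
Definition spectral_projection A (S : set R) : H -> H :=
  xget (fun _ _ => 0) [set E | is_spectral_measure A E] S.

Definition spectral_section_at (r : R) A P : Prop :=
  [/\ orthogonal_projection P,
      le_operator (spectral_projection A `[r, +oo[) P &
      le_operator P (spectral_projection A `](- r), +oo[)].

Definition trivializing_operator (r : R) A C : Prop :=
  [/\ bounded_selfadjoint C, finite_rank C, invertible (op_add A C) &
      range C `<=` range (spectral_projection A `](- r), r[)].

Section Families.
Variables (X : topologicalType) (r : X -> R) (F : X -> set (H * H)).
Implicit Types (p c : X -> H -> H).

Definition spectral_section p : Prop :=
  norm_continuous p /\ forall x, spectral_section_at (r x) (F x) (p x).

Definition trivializing_family c : Prop :=
  norm_continuous c /\ forall x, trivializing_operator (r x) (F x) (c x).

Definition agrees_with c p : Prop :=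
  forall x, p x = spectral_projection (op_add (F x) (c x)) `[0, +oo[.

End Families.

End Operators.

(* Main.v *)
Require Import Defs.
From mathcomp Require Import measurable_realfun ring lra.
Import Order.TTheory GRing.Theory Num.Theory.
Import numFieldNormedType.Exports.
Local Open Scope classical_set_scope.
Local Open Scope ring_scope.

(** Each [A_x] has an orthonormal basis of eigenvectors: a maximizer of [|Kv|^2]
    over the orthogonal complement of all eigenvectors, [K = (A + i)^-1], would be
    an eigenvector of [K^* K = (1 + A^2)^-1], hence produce one of [A].  Take
    [C = r (2 P - 1) - clamp_r(A)], where [clamp_r(t) = max(-r, min(t, r))].
    Since [P] is 1 above [r] and 0 below [-r], [C] vanishes outside the range [V] of
    [1_(-r,r)(A)], a finite-dimensional space preserved by [P], and on [V] one has
    [A + C = r (2 P - 1)].  Thus [A + C] is invertible with positive spectral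
    projection [P], and [|C| <= r + max |spec(A|V)| < 2 r].  For the continuity of
    [clamp_r(A_x)]: the functions [p] such that [p(A_x)] is norm continuous contain
    the bounded transform and are stable under algebraic operations, uniform limits,
    square roots and inverses of functions bounded below, and [clamp_r] is obtained
    from the bounded transform by these operations. *)

Set Implicit Arguments.
Unset Strict Implicit.
Unset Printing Implicit Defensive.

(** [spectral_projection] and [bounded_transform] are choices among objects meeting a specification,
    so existence and uniqueness of both have to be settled, by means of eigenbases, before any
    concrete formula holds for them. The eigenbasis of [A_x] is picked separately for each [x] and
    has no continuity in [x]; it serves pointwise identities and estimates only, and continuity is a
    statement about the operators [p(A_x)]. This is what dictates the clamp. Cutting
    [r (2 P - 1) - A] off to [V] directly would involve [1_(-r,r)(A_x)], which jumps when an
    eigenvalue crosses [r] or [- r]; [clamp_r] is continuous, and it cancels [r (2 P - 1)] outside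
    [(-r, r)], so no cutoff is left. Its limits at plus and minus infinity differ, which is why its
    continuity is derived from the bounded transform and not from the resolvent. *)

Local Notation "'[ u , v ]" := (inner _ u v).
Local Notation N := (@rnorm _ _).
Local Notation nc := (@ComplexField.Normc.normc _).
Local Notation Re := (@complex.Re _).
Local Notation Im := (@complex.Im _).

(** * Hilbert spaces *)

Section HilbertBasics.
Variables (R : realType) (H : hilbertSpace R).
Implicit Types (u v w : H) (a b : R[i]).

Lemma ipDl u v w : '[u + v, w] = '[u, w] + '[v, w].
Proof. by rewrite linearDl. Qed.
Lemma ipDr u v w : '[u, v + w] = '[u, v] + '[u, w].
Proof. by rewrite linearDr. Qed.
Lemma ipNl u w : '[- u, w] = - '[u, w].
Proof. by rewrite linearNl. Qed.
Lemma ipNr u w : '[u, - w] = - '[u, w].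
Proof. by rewrite linearNr. Qed.
Lemma ip0l w : '[0, w] = 0.
Proof. by rewrite linear0l. Qed.
Lemma ip0r w : '[w, 0] = 0.
Proof. by rewrite linear0r. Qed.
Lemma ipZl a u w : '[a *: u, w] = a * '[u, w].
Proof. by rewrite linearZl_LR. Qed.
Lemma ipZr a u w : '[u, a *: w] = a^*%C * '[u, w].
Proof. by rewrite linearZr_LR. Qed.
Lemma ipC u v : '[u, v] = ('[v, u])^*%C.
Proof. by rewrite hermC mul1r. Qed.
Lemma ipBl u v w : '[u - v, w] = '[u, w] - '[v, w].
Proof. by rewrite ipDl ipNl. Qed.
Lemma ipBr u v w : '[u, v - w] = '[u, v] - '[u, w].
Proof. by rewrite ipDr ipNr. Qed.
Lemma rnormE v : (N v)%:C%C = `|v|.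
Proof. by rewrite /rnorm RRe_real// ger0_real. Qed.
Lemma ipvv v : '[v, v] = (N v ^+ 2)%:C%C.
Proof. by rewrite -inner_norm -rnormE rmorphXn. Qed.
Lemma rnorm_ge0 v : 0 <= N v.
Proof. by rewrite -ler0c rnormE. Qed.
Lemma rnorm0 : N (0 : H) = 0.
Proof. by rewrite /rnorm normr0. Qed.
Lemma rnorm_eq0 v : N v = 0 -> v = 0.
Proof. by move=> h; apply/normr0_eq0; rewrite -rnormE h. Qed.
Lemma ip_eq0 v : '[v, v] = 0 -> v = 0.
Proof.
by rewrite ipvv => -[] /eqP; rewrite expf_eq0 => /eqP /rnorm_eq0.
Qed.
Lemma nc_def a : `|a| = (nc a)%:C%C. Proof. by []. Qed.
Lemma rnormZ a v : N (a *: v) = nc a * N v.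
Proof. by apply: complexI; rewrite rmorphM/= !rnormE normrZ. Qed.
Lemma rnormD u v : N (u + v) <= N u + N v.
Proof. by rewrite -lecR rmorphD/= !rnormE ler_normD. Qed.
Lemma rnormN v : N (- v) = N v.
Proof. by rewrite /rnorm normrN. Qed.
Lemma rnormBC u v : N (u - v) = N (v - u).
Proof. by rewrite -rnormN opprB. Qed.
Lemma rnormB u v : N (u - v) <= N u + N v.
Proof. by rewrite -(rnormN v) rnormD. Qed.
Lemma nc_ge0 a : 0 <= nc a. Proof. by rewrite -ler0c -nc_def. Qed.
Lemma ncE a : nc a ^+ 2 = Re a ^+ 2 + Im a ^+ 2.
Proof. by apply: complexI; rewrite add_Re2_Im2 rmorphXn. Qed.
Lemma mul_conj a : a * a^*%C = (nc a ^+ 2)%:C%C.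
Proof. by rewrite rmorphXn/= -nc_def normCK. Qed.
Lemma ncJ a : nc a^*%C = nc a.
Proof. by apply: complexI; rewrite -!nc_def norm_conjC. Qed.
Lemma ncR (x : R) : nc x%:C%C = `|x|.
Proof. by rewrite /= expr0n addr0 sqrtr_sqr. Qed.
Lemma nc0 : nc (0 : R[i]) = 0.
Proof. by rewrite -[X in nc X]/((0:R)%:C%C) ncR normr0. Qed.
Lemma rnormZR (x : R) v : N (x%:C%C *: v) = `|x| * N v.
Proof. by rewrite rnormZ ncR. Qed.

Lemma conjM a b : (a * b)^*%C = a^*%C * b^*%C. Proof. exact: rmorphM. Qed.
Lemma ReD a b : Re (a + b) = Re a + Re b. Proof. by case: a; case: b. Qed.
Lemma ReN a : Re (- a) = - Re a. Proof. by case: a. Qed.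
Lemma ReJ a : Re (a^*%C) = Re a. Proof. by case: a. Qed.
Lemma ReZ (x : R) a : Re (x%:C%C * a) = x * Re a.
Proof. by case: a => p q /=; rewrite mul0r subr0. Qed.

Lemma rnorm_sqE v : N v ^+ 2 = Re '[v, v].
Proof. by rewrite ipvv. Qed.
Lemma rnorm_sqD u v : N (u + v) ^+ 2 = N u ^+ 2 + N v ^+ 2 + 2 * Re '[u, v].
Proof. by rewrite !rnorm_sqE ipDl !ipDr (ipC v u) !ReD ReJ; ring. Qed.
Lemma rnorm_sqB u v : N (u - v) ^+ 2 = N u ^+ 2 + N v ^+ 2 - 2 * Re '[u, v].
Proof. by rewrite rnorm_sqD rnormN ipNr ReN; ring. Qed.
Lemma rnorm_neq0 v : v != 0 -> N v != 0.
Proof. by apply: contra_neq => /rnorm_eq0. Qed.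

(** Pythagoras for the component of [u] orthogonal to [v]. It yields both the Cauchy-Schwarz
    inequality and the variational step in [orth_decomp]. *)
Lemma rnorm_sub_proj u v : v != 0 ->
  N (u - ('[u, v] / (N v ^+ 2)%:C%C) *: v) ^+ 2 =
  N u ^+ 2 - nc '[u, v] ^+ 2 / N v ^+ 2.
Proof.
move=> v0; have {}v0 := rnorm_neq0 v0.
set c := _ / _; apply: complexI; rewrite -ipvv.
have nz : (N v ^+ 2)%:C%C != 0 :> R[i] by rewrite fmorph_eq0 expf_eq0.
have -> : (N u ^+ 2 - nc '[u, v] ^+ 2 / N v ^+ 2)%:C%C =
   (N u ^+ 2)%:C%C - '[u, v] * '[u, v]^*%C / (N v ^+ 2)%:C%C.
  by rewrite mul_conj rmorphB fmorph_div.
have cJ : c^*%C = '[u, v]^*%C / (N v ^+ 2)%:C%C.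
  rewrite /c [LHS]rmorphM; congr (_ * _).
  by apply: etrans (conjc_inv _) _; rewrite conjc_real.
rewrite ipBl !ipBr !ipZl !ipZr (ipC v u) !ipvv cJ /c.
by move: nz; move: (_%:C%C) => z nz; field.
Qed.

Lemma CauchySchwarz u v : nc '[u, v] <= N u * N v.
Proof.
have [->|v0] := eqVneq v 0.
  by rewrite ip0r rnorm0 mulr0 nc0.
have Nv : 0 < N v by rewrite lt_def rnorm_neq0 ?rnorm_ge0.
have := sqr_ge0 (N (u - ('[u, v] / (N v ^+ 2)%:C%C) *: v)).
rewrite rnorm_sub_proj// subr_ge0 ler_pdivrMr ?exprn_gt0// -exprMn.
by rewrite ler_sqr ?nnegrE ?mulr_ge0 ?rnorm_ge0 ?nc_ge0.
Qed.

Lemma Re_le_nc a : `|Re a| <= nc a.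
Proof.
rewrite -ler_sqr ?nnegrE ?nc_ge0// ncE real_normK ?num_real// lerDl sqr_ge0//.
Qed.

Lemma nc_eq0 a : nc a = 0 -> a = 0.
Proof. exact: ComplexField.Normc.eq0_normc. Qed.

Lemma ncD a b : nc (a + b) <= nc a + nc b.
Proof. exact: le_normcD. Qed.
Lemma ip_ext v w : (forall z, '[v, z] = '[w, z]) -> v = w.
Proof.
move=> h; apply/eqP; rewrite -subr_eq0; apply/eqP/ip_eq0.
by rewrite ipBl h subrr.
Qed.
End HilbertBasics.

(* Pairing both sides with an arbitrary vector reduces an identity between
   linear combinations of vectors to one between scalars. *)
Ltac vec := apply: ip_ext => ?; rewrite ?(ipDl, ipNl, ipZl, ip0l); ring.

(** * Convergence of sequences and projection onto closed subspaces *)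

Section HilbertConvergence.
Variables (R : realType) (H : hilbertSpace R).
Implicit Types (u : nat -> H) (v w x y : H) (a b : R[i]).

(** Convergence in the real-valued norm, so that estimates avoid the partial order of [R[i]]. *)
Definition hcvg u v := forall e : R, 0 < e ->
  exists n0, forall n, (n0 <= n)%N -> N (u n - v) < e.

Definition hcauchy u := forall e : R, 0 < e ->
  exists n0, forall m n, (n0 <= m)%N -> (n0 <= n)%N -> N (u m - u n) < e.

Lemma ball_rnorm v w (e : R) : ball v e%:C%C w <-> N (v - w) < e.
Proof. by rewrite -ball_normE /ball_/= -rnormE ltcR. Qed.

Lemma hcauchy_cvg u : hcauchy u -> exists v, hcvg u v.
Proof.
move=> cu.
have /cauchy_cvgP /cvg_ex[v /cvg_ballP uv] : cauchy (u @ \oo).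
  apply: cauchy_exP => e e0.
  have eR : e = (Re e)%:C%C by rewrite RRe_real// gtr0_real.
  have e0' : 0 < Re e by rewrite -ltcR -eR.
  have [n0 hn] := cu _ e0'.
  exists (u n0); exists n0 => //= n /= n0n.
  by rewrite eR; apply/ball_rnorm/hn.
exists v => e e0.
have e0' : 0 < e%:C%C :> R[i] by rewrite ltcR.
have [n0 _ hn] := uv _ e0'.
exists n0 => n /hn /= /ball_rnorm.
by rewrite rnormBC.
Qed.

Lemma le_eps (x y : R) : (forall e, 0 < e -> x <= y + e) -> x <= y.
Proof. by move=> h; apply/ler_addgt0Pr. Qed.

Lemma rnorm_le_lim u v (M : R) n0 :
  hcvg u v -> (forall n, (n0 <= n)%N -> N (u n) <= M) -> N v <= M.
Proof.
move=> uv uM; apply: le_eps => e e0.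
have [n1 h1] := uv _ e0.
have {}h1 := h1 _ (leq_maxr n0 n1); have h2 := uM _ (leq_maxl n0 n1).
rewrite -[v](subrK (u (maxn n0 n1))) addrC.
by apply: le_trans (rnormD _ _) _; rewrite lerD// rnormBC ltW.
Qed.

Lemma ip_lim u v w a : hcvg u v ->
  (forall e : R, 0 < e -> exists n0, forall n, (n0 <= n)%N -> nc ('[u n, w] - a) < e) ->
  '[v, w] = a.
Proof.
move=> uv h; apply/eqP; rewrite -subr_eq0; apply/eqP/nc_eq0.
apply/eqP; rewrite eq_le nc_ge0 andbT; apply: le_eps => e e0.
have e2 : 0 < e / 2 by rewrite divr_gt0.
have Nw : 0 < 1 + N w by rewrite ltr_pwDl// rnorm_ge0.
have e3 : 0 < e / 2 / (1 + N w) by rewrite !divr_gt0.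
have [n1 h1] := uv _ e3; have [n2 h2] := h _ e2.
have {}h1 := h1 _ (leq_maxl n1 n2); have {}h2 := h2 _ (leq_maxr n1 n2).
set n := maxn n1 n2 in h1 h2.
have -> : '[v, w] - a = '[v - u n, w] + ('[u n, w] - a).
  by rewrite ipBl subrKA.
apply: le_trans (ncD _ _) _; rewrite add0r [leRHS]splitr lerD ?ltW//.
apply: le_lt_trans (CauchySchwarz _ _) _; rewrite rnormBC.
apply: (@le_lt_trans _ _ (N (u n - v) * (1 + N w))).
  by rewrite ler_wpM2l ?rnorm_ge0// lerDr.
by rewrite -ltr_pdivlMr.
Qed.

Lemma ip_lim_cst u v w a : hcvg u v -> (forall n, '[u n, w] = a) -> '[v, w] = a.
Proof.
move=> uv h; apply: ip_lim uv _ => e e0; exists 0%N => n _.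
by rewrite h subrr nc0.
Qed.

Definition subspace (M : set H) :=
  M 0 /\ forall a v w, M v -> M w -> M (a *: v + w).
Definition seq_closed (M : set H) :=
  forall u v, (forall n, M (u n)) -> hcvg u v -> M v.

(** The distance from [v] to [M] is attained, because a minimizing sequence is Cauchy by the
    parallelogram law. At a nearest point [x], subtracting from [v - x] its component along [y]
    would lower the squared distance by [|<v - x, y>|^2 / |y|^2], which must therefore vanish. *)
Lemma orth_decomp (M : set H) v : subspace M -> seq_closed M ->
  exists2 x, M x & forall y, M y -> '[v - x, y] = 0.
Proof.
move=> [M0 Ml] Mc.
pose S := [set N (v - x) ^+ 2 | x in M].
have S0 : S !=set0 by exists (N (v - 0) ^+ 2), 0.
have Slb : has_lbound S by exists 0 => _ [x _ <-]; rewrite sqr_ge0.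
have dS x : M x -> inf S <= N (v - x) ^+ 2.
  by move=> Mx; apply: ge_inf => //; exists x.
have /choice[u hu] : forall n : nat, exists x, M x /\ N (v - x) ^+ 2 < inf S +
  n.+1%:R^-1.
  move=> n; have [|_ [x Mx <-] hx] := @inf_adherent _ S n.+1%:R^-1 _ (conj S0 Slb).
    by rewrite invr_gt0.
  by exists x.
have half : forall x y, M x -> M y -> M (((2^-1 : R)%:C%C) *: (x + y)).
  move=> x y Mx My; rewrite -[_ *: _]addr0; apply: (Ml _ _ _) => //.
  by rewrite -[x]scale1r; exact: (Ml _ _ _).
(* Parallelogram law for [v - u m] and [v - u n]: half of their sum is the difference of [v] and a
   midpoint in [M], so the square of the sum is at least [4 * inf S]. *)
have par m n : N (u m - u n) ^+ 2 <= 2 * m.+1%:R^-1 + 2 * n.+1%:R^-1.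
  have [Mm hm] := hu m; have [Mn hn] := hu n.
  have h1 := rnorm_sqD (v - u m) (v - u n).
  have h2 := rnorm_sqB (v - u m) (v - u n).
  have h3 : 4 * inf S <= N (v - u m + (v - u n)) ^+ 2.
    have -> : v - u m + (v - u n) = (2:R)%:C%C *: (v - ((2^-1 : R)%:C%C) *: (u m + u
      n)).
      rewrite scalerBr scalerA -rmorphM/= divff// scale1r.
      by rewrite -[2]/(1+1) rmorphD scalerDl scale1r addrACA opprD.
    rewrite rnormZR exprMn ger0_norm// (_ : 2 ^+ 2 = 4)//; last by ring.
    by rewrite ler_pM2l// dS//; apply: half.
  have h4 : v - u m - (v - u n) = - (u m - u n) by rewrite opprB addrC addrA subrK
    opprB addrC.
  rewrite -[u m - u n]opprK -h4 rnormN h2.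
  move: h1 h3 hm hn; move: m.+1%:R^-1 n.+1%:R^-1 (inf S) (Re _) => p q s t.
  by move=> -> h3 hm hn; lra.
have cu : hcauchy u.
  move=> e e0.
  have [n0 hn0] : exists n : nat, 4 / e ^+ 2 < n.+1%:R.
    exists (Num.truncn (4 / e ^+ 2)).
    by rewrite truncnS_gt// divr_ge0// exprn_ge0// ltW.
  have e2 : 0 < e ^+ 2 by rewrite exprn_gt0.
  exists n0 => m n nm nn; rewrite -ltr_sqr ?nnegrE ?rnorm_ge0 ?ltW//.
  apply: le_lt_trans (par _ _) _.
  have hh k : (n0 <= k)%N -> k.+1%:R^-1 < e ^+ 2 / 4.
    move=> nk; rewrite invf_plt ?posrE ?divr_gt0// invf_div.
    by apply: lt_le_trans hn0 _; rewrite ler_nat.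
  have := hh _ nm; have := hh _ nn; move: m.+1%:R^-1 n.+1%:R^-1 => p q.
  by move: (e ^+ 2) => t; lra.
have [x ux] := hcauchy_cvg cu.
have Mx : M x by apply: Mc ux => n; case: (hu n).
exists x => // y My; have [->|y0] := eqVneq y 0; first exact: ip0r.
apply: nc_eq0; apply/eqP; rewrite -sqrf_eq0 eq_le sqr_ge0 andbT.
have Ny : 0 < N y ^+ 2.
  by rewrite exprn_gt0// lt_def rnorm_ge0 andbT; apply: contra_neq y0 => /rnorm_eq0.
suff dx : N (v - x) ^+ 2 <= inf S.
  have := rnorm_sub_proj (v - x) y0; set c := _ / _ => hc.
  have := dS (c *: y + x) (Ml _ _ _ My Mx).
  have -> : v - (c *: y + x) = v - x - c *: y.
    by rewrite opprD (addrC (- (c *: y))) addrA.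
  rewrite hc => h.
  have : nc '[v - x, y] ^+ 2 / N y ^+ 2 <= 0.
    by move: h dx; move: (_ / _) (inf S) (_ ^+ 2) => p q t; lra.
  by rewrite pmulr_lle0// invr_gt0.
apply: le_eps => e e0.
have iS : 0 <= inf S.
  by apply: lb_le_inf => // _ [z _ <-]; rewrite sqr_ge0.
have ie : 0 <= inf S + e by rewrite addr_ge0// ltW.
rewrite -(sqr_sqrtr ie) ler_sqr ?nnegrE ?rnorm_ge0 ?sqrtr_ge0//.
have vu : hcvg (fun n => v - u n) (v - x).
  move=> d /ux[n0 hn]; exists n0 => n /hn.
  have -> : v - u n - (v - x) = x - u n by rewrite opprB addrC addrA subrK.
  by rewrite rnormBC.
apply: (rnorm_le_lim (n0 := Num.truncn e^-1) vu) => n hn.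
rewrite -ler_sqr ?nnegrE ?rnorm_ge0 ?sqrtr_ge0// sqr_sqrtr//.
case: (hu n) => _ /ltW /le_trans; apply; rewrite lerD2l.
rewrite invf_ple ?posrE// ltW//.
apply: lt_le_trans (truncnS_gt _) _.
by rewrite ler_nat.
Qed.

End HilbertConvergence.

(** * Orthonormal systems *)

Section OrthonormalSystems.
Variables (R : realType) (H : hilbertSpace R).
Implicit Types (v w x y : H).

(* Zero vectors are allowed, so that any countable orthonormal set, finite or not,
   can be indexed by [nat]. *)
Definition orthosys (e : nat -> H) :=
  (forall n, e n = 0 \/ N (e n) = 1) /\ forall m n, m != n -> '[e m, e n] = 0.

Definition total (S : set H) := forall v, (forall w, S w -> '[v, w] = 0) -> v = 0.

Lemma ip_suml I (r : seq I) (F : I -> H) w :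
  '[\sum_(i <- r) F i, w] = \sum_(i <- r) '[F i, w].
Proof.
by elim/big_rec2: _ => [|i y1 y2 _ <-]; rewrite ?ip0l// ipDl.
Qed.

Lemma hcvg_Re_ip (u : nat -> H) v w : hcvg u v -> Re '[u n, w] @[n --> \oo] --> Re '[v,
  w].
Proof.
move=> uv; apply/cvgrPdist_lt => e e0.
have Nw : 0 < 1 + N w by rewrite ltr_pwDl// rnorm_ge0.
have e3 : 0 < e / (1 + N w) by rewrite !divr_gt0.
have [n1 h1] := uv _ e3.
exists n1 => // n /= /h1 h.
rewrite -ReN -ReD -ipBl; apply: le_lt_trans (Re_le_nc _) _.
apply: le_lt_trans (CauchySchwarz _ _) _; rewrite rnormBC.
apply: (@le_lt_trans _ _ (N (u n - v) * (1 + N w))).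
  by rewrite ler_wpM2l ?rnorm_ge0// lerDr.
by rewrite -ltr_pdivlMr.
Qed.

Section System.
Variables (e : nat -> H) (oe : orthosys e).

Definition psum (a : nat -> R[i]) K := \sum_(0 <= i < K) a i *: e i.
(** A coefficient at a zero vector cannot be recovered as an inner product, so admissible sequences
    vanish there. *)
Definition compat (a : nat -> R[i]) := forall n, e n = 0 -> a n = 0.

Lemma compat_cf v : compat (fun n => '[v, e n]).
Proof. by move=> n ->; rewrite ip0r. Qed.

Lemma ip_sys a n : compat a -> a n * '[e n, e n] = a n.
Proof.
move=> ca; case: (oe.1 n) => [e0|e1]; first by rewrite ca// mul0r.
by rewrite ipvv e1 expr1n mulr1.
Qed.

Lemma cf_sum (a : nat -> R[i]) m K n : compat a ->
  '[\sum_(m <= i < K) a i *: e i, e n] = if (m <= n < K)%N then a n else 0.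
Proof.
move=> ca; rewrite ip_suml.
transitivity (\sum_(m <= i < K) if i == n then a n else 0).
  apply: eq_bigr => i _; rewrite ipZl; case: eqVneq => [->|ne].
    exact: ip_sys.
  by rewrite oe.2// mulr0.
by rewrite -big_mkcond big_nat1_eq.
Qed.

Lemma ReM_conj (a : R[i]) : Re (a * a^*%C) = nc a ^+ 2.
Proof. by rewrite mul_conj. Qed.

Lemma ip_psum (a : nat -> R[i]) m K v :
  '[\sum_(m <= i < K) a i *: e i, v] = \sum_(m <= i < K) a i * '[v, e i]^*%C.
Proof. by rewrite ip_suml; apply: eq_bigr => i _; rewrite ipZl -ipC. Qed.

Lemma Re_sum I (r : seq I) (P : pred I) (F : I -> R[i]) :
  Re (\sum_(i <- r | P i) F i) = \sum_(i <- r | P i) Re (F i).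
Proof. by elim/big_rec2: _ => //= i y1 y2 _ <-; rewrite ReD. Qed.

Lemma rnorm_sum (a : nat -> R[i]) m K : compat a ->
  N (\sum_(m <= i < K) a i *: e i) ^+ 2 = \sum_(m <= i < K) nc (a i) ^+ 2.
Proof.
move=> ca; rewrite rnorm_sqE ip_psum Re_sum; apply: eq_big_nat => i mi.
by rewrite cf_sum// mi ReM_conj.
Qed.

Lemma bessel v K : \sum_(0 <= i < K) nc '[v, e i] ^+ 2 <= N v ^+ 2.
Proof.
have := sqr_ge0 (N (v - psum (fun n => '[v, e n]) K)).
rewrite rnorm_sqB rnorm_sum; last exact: compat_cf.
rewrite ipC ReJ ip_psum Re_sum.
under [X in _ - 2 * X]eq_bigr do rewrite ReM_conj.
by set s := \sum_(_ <= _ < _) _ => h; lra.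
Qed.

(** The sums of squares increase to a finite limit, so by Pythagoras the vector partial sums are
    Cauchy. The norm bound is recorded because it turns bounds on coefficients into bounds on
    norms. *)
Lemma riesz_fischer a (M : R) : compat a ->
  (forall K, \sum_(0 <= i < K) nc (a i) ^+ 2 <= M) ->
  exists w, [/\ hcvg (psum a) w, forall n, '[w, e n] = a n & N w ^+ 2 <= M].
Proof.
move=> ca aM.
pose S K := \sum_(0 <= i < K) nc (a i) ^+ 2.
have M0 : 0 <= M by have := aM 0%N; rewrite big_nil.
have ndS : nondecreasing_seq S.
  apply/nondecreasing_seqP => n.
  by rewrite /S big_nat_recr//= lerDl sqr_ge0.
have /nondecreasing_is_cvgn cS := ndS.
have {}cS : cvg (S @ \oo) by apply: cS; exists M => _ [n _ <-]; exact: aM.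
have cauS : hcauchy (psum a).
  move=> d d0; have d2 : 0 < d ^+ 2 by rewrite exprn_gt0.
  have d4 : 0 < d ^+ 2 / 2 by rewrite divr_gt0.
  move: cS => /cvg_ex[l /cvgrPdist_lt/(_ _ d4)[n0 _ hn]].
  exists n0.
  have wl m n : (n0 <= m)%N -> (m <= n)%N -> N (psum a m - psum a n) < d.
    move=> nm mn; have nn := leq_trans nm mn.
    rewrite rnormBC -ltr_sqr ?nnegrE ?rnorm_ge0 ?ltW//.
    have SD : S n = S m + \sum_(m <= i < n) nc (a i) ^+ 2.
      by rewrite /S -big_cat_nat.
    have -> : psum a n - psum a m = \sum_(m <= i < n) a i *: e i.
      by rewrite /psum (big_cat_nat (leq0n m) mn)/= addrAC subrr add0r.
    rewrite rnorm_sum//.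
    have := hn _ nm; have := hn _ nn; rewrite /= SD;
      move: (S m) (\sum_(_ <= _ < _) _) => p q.
    by rewrite !ltr_norml; lra.
  move=> m n nm nn; case: (leqP m n) => [|/ltnW] mn; first exact: wl.
  by rewrite rnormBC; exact: wl.
have [w hw] := hcauchy_cvg cauS.
exists w; split => //.
  move=> n; apply: ip_lim hw _ => d d0; exists n.+1 => K nK.
  by rewrite cf_sum// leq0n nK subrr nc0.
rewrite -(sqr_sqrtr M0) ler_sqr ?nnegrE ?rnorm_ge0 ?sqrtr_ge0//.
apply: (rnorm_le_lim (n0 := 0) hw) => n _.
rewrite -ler_sqr ?nnegrE ?rnorm_ge0 ?sqrtr_ge0// sqr_sqrtr//.
by rewrite rnorm_sum.
Qed.

Hypothesis te : total (range e).

Lemma total_eq v w : (forall n, '[v, e n] = '[w, e n]) -> v = w.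
Proof.
move=> h; apply/eqP; rewrite -subr_eq0; apply/eqP/te => _ [n _ <-].
by rewrite ipBl h subrr.
Qed.

Lemma psum_cvg v : hcvg (psum (fun n => '[v, e n])) v.
Proof.
have [w [h cw _]] := riesz_fischer (@compat_cf v) (bessel v).
by rewrite -{2}(total_eq cw).
Qed.

Lemma parseval v w :
  (\sum_(0 <= i < K) Re ('[v, e i] * '[w, e i]^*%C)) @[K --> \oo] --> Re '[v, w].
Proof.
have := hcvg_Re_ip (w := w) (psum_cvg v).
by under eq_cvg do rewrite /psum ip_psum Re_sum.
Qed.

(** Bessel for [w] bounds the squared coefficients of [v]; the vector that Riesz-Fischer rebuilds
    from them obeys the same bound and equals [v] by totality. *)
Lemma coef_le v w (M : R) : 0 <= M ->
  (forall n, nc '[v, e n] <= M * nc '[w, e n]) -> N v <= M * N w.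
Proof.
move=> M0 h; rewrite -ler_sqr ?nnegrE ?mulr_ge0 ?rnorm_ge0//.
have hb K : \sum_(0 <= i < K) nc '[v, e i] ^+ 2 <= (M * N w) ^+ 2.
  rewrite exprMn; apply: le_trans (_ : M ^+ 2 * \sum_(0 <= i < K) nc '[w, e i] ^+ 2 <=
    _).
    rewrite mulr_sumr; apply: ler_sum => i _; rewrite -exprMn.
    by rewrite ler_sqr ?nnegrE ?mulr_ge0 ?nc_ge0.
  by rewrite ler_wpM2l ?sqr_ge0// bessel.
have [x [_ cx hx]] := riesz_fischer (@compat_cf v) hb.
by rewrite -(total_eq cx).
Qed.

Lemma diag_ex (c : nat -> R) (M : R) v : 0 <= M ->
  (forall n, e n != 0 -> `|c n| <= M) ->
  exists w, forall n, '[w, e n] = (c n)%:C%C * '[v, e n].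
Proof.
move=> M0 cM.
have ca : compat (fun n => (c n)%:C%C * '[v, e n]).
  by move=> n /compat_cf ->; rewrite mulr0.
have hb K : \sum_(0 <= i < K) nc ((c i)%:C%C * '[v, e i]) ^+ 2 <= (M * N v) ^+ 2.
  rewrite exprMn; apply: le_trans (_ : M ^+ 2 * \sum_(0 <= i < K) nc '[v, e i] ^+ 2 <=
    _).
    rewrite mulr_sumr; apply: ler_sum => i _; rewrite -exprMn.
    have [->|/cM h] := eqVneq (e i) 0; first by rewrite ip0r !mulr0 nc0 mulr0.
    rewrite ler_sqr ?nnegrE ?mulr_ge0 ?nc_ge0//.
    by rewrite ComplexField.Normc.normcM ncR ler_wpM2r// nc_ge0.
  by rewrite ler_wpM2l ?sqr_ge0// bessel.
have [x [_ cx hx]] := riesz_fischer ca hb.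
by exists x.
Qed.

End System.
End OrthonormalSystems.

(** * Self-adjoint operators with compact resolvents *)

Section SelfAdjoint.
Variables (R : realType) (H : hilbertSpace R).
Implicit Types (v w x y : H).

Local Notation i := ('i%C : R[i]).

(** The zero vector counts as an eigenvector for every [l], in accordance with systems padded by
    zeros. *)
Definition eigenvector (A : set (H * H)) (l : R) v := A (v, l%:C%C *: v).
Definition eigenvectors (A : set (H * H)) (L : set R) : set H :=
  [set v | exists2 l, L l & eigenvector A l v].

Variables (A : set (H * H)) (saA : adjoint A = A).

Lemma sa_sym v w x y : A (v, w) -> A (x, y) -> '[w, x] = '[v, y].
Proof. by move=> h; rewrite -{1}saA => /(_ _ h). Qed.

(** Membership in the graph is tested through the adjoint; linearity and closedness of the graph
    both follow from this form. *)
Lemma sa_intro x y : (forall v w, A (v, w) -> '[w, x] = '[v, y]) -> A (x, y).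
Proof. by move=> h; rewrite -saA => -[v w] /h. Qed.

Lemma sa_lin a v w x y : A (v, w) -> A (x, y) -> A (a *: v + x, a *: w + y).
Proof.
move=> h1 h2; apply: sa_intro => p q pq.
by rewrite !ipDr !ipZr (sa_sym pq h1) (sa_sym pq h2).
Qed.

Lemma sa_0 : A (0, 0).
Proof. by apply: sa_intro => p q _; rewrite !ip0r. Qed.

Lemma sa_Z a v w : A (v, w) -> A (a *: v, a *: w).
Proof. by move=> h; have := sa_lin a h sa_0; rewrite !addr0. Qed.

Lemma sa_D v w x y : A (v, w) -> A (x, y) -> A (v + x, w + y).
Proof. by move=> h /(sa_lin 1 h); rewrite !scale1r. Qed.

Lemma sa_B v w x y : A (v, w) -> A (x, y) -> A (v - x, w - y).
Proof. by move=> h h'; have := sa_D h (sa_Z (-1) h'); rewrite !scaleN1r. Qed.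

Lemma ip_limr (u : nat -> H) v w a : hcvg u v ->
  (forall d : R, 0 < d -> exists n0, forall n, (n0 <= n)%N -> nc ('[w, u n] - a) < d) ->
  '[w, v] = a.
Proof.
move=> uv h; rewrite ipC; apply: (canLR (@conjcK R)).
apply: (ip_lim uv) => d /h [n0 hn]; exists n0 => n /hn.
by rewrite -ncJ rmorphB/= -ipC.
Qed.

Lemma ip_cvgr (u : nat -> H) v w : hcvg u v ->
  forall d : R, 0 < d -> exists n0, forall n, (n0 <= n)%N -> nc ('[w, u n] - '[w, v]) <
    d.
Proof.
move=> uv d d0.
have Nw : 0 < 1 + N w by rewrite ltr_pwDl// rnorm_ge0.
have e3 : 0 < d / (1 + N w) by rewrite !divr_gt0.
have [n1 h1] := uv _ e3.
exists n1 => n /= /h1 h.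
rewrite -ipBr.
apply: le_lt_trans (CauchySchwarz _ _) _.
apply: (@le_lt_trans _ _ ((1 + N w) * N (u n - v))).
  by rewrite ler_wpM2r ?rnorm_ge0// lerDr.
by rewrite mulrC -ltr_pdivlMr.
Qed.

Lemma sa_closed (u s : nat -> H) v w : (forall n, A (u n, s n)) ->
  hcvg u v -> hcvg s w -> A (v, w).
Proof.
move=> As uv sw; apply: sa_intro => p q pq.
apply: (ip_limr uv) => d /(ip_cvgr p sw)[n0 hn]; exists n0 => n /hn.
by rewrite (sa_sym pq (As n)).
Qed.

Lemma eigen_orth l m v w : l != m -> eigenvector A l v -> eigenvector A m w ->
  '[v, w] = 0.
Proof.
move=> lm Av Aw; have := sa_sym Av Aw; rewrite ipZl ipZr conjc_real => /eqP.
rewrite -subr_eq0 -mulrBl mulf_eq0 -rmorphB fmorph_eq0 subr_eq0 (negbTE lm)/=.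
by move/eqP.
Qed.

Lemma ip_real v w : A (v, w) -> Im '[w, v] = 0.
Proof.
move=> h; have := sa_sym h h; rewrite (ipC v w).
by case: ('[w, v]) => a b [] /= /eqP; rewrite -addr_eq0 -mulr2n mulrn_eq0 => /eqP.
Qed.

(** Since ['[w, v]] is real, the cross term is the real part of an imaginary number. Hence [A + i]
    and, likewise, [A - i] are bounded below. *)
Lemma rnorm_addi v w : A (v, w) -> N (w + i *: v) ^+ 2 = N w ^+ 2 + N v ^+ 2.
Proof.
move=> h; rewrite rnorm_sqD rnormZ ipZr; have := ip_real h.
case: ('[w, v]) => a b /= ->; rewrite expr0n/= expr1n add0r sqrtr1; ring.
Qed.

Lemma rnorm_subi v w : A (v, w) -> N (w - i *: v) ^+ 2 = N w ^+ 2 + N v ^+ 2.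
Proof.
move=> h; rewrite rnorm_sqB rnormZ ipZr; have := ip_real h.
case: ('[w, v]) => a b /= ->; rewrite expr0n/= expr1n add0r sqrtr1; ring.
Qed.

Lemma le_sq_rnorm v w (t : R) : N w ^+ 2 = t + N v ^+ 2 -> 0 <= t -> N v <= N w.
Proof.
by move=> h t0; rewrite -ler_sqr ?nnegrE ?rnorm_ge0// h lerDr.
Qed.

Lemma hcvgZ (u : nat -> H) v a : hcvg u v -> hcvg (fun n => a *: u n) (a *: v).
Proof.
move=> uv d d0.
have Nw : 0 < 1 + nc a by rewrite ltr_pwDl// nc_ge0.
have e3 : 0 < d / (1 + nc a) by rewrite !divr_gt0.
have [n1 h1] := uv _ e3.
exists n1 => n /= /h1 h; rewrite -scalerBr rnormZ.
apply: (@le_lt_trans _ _ ((1 + nc a) * N (u n - v))).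
  by rewrite ler_wpM2r ?rnorm_ge0// lerDr.
by rewrite mulrC -ltr_pdivlMr.
Qed.

Lemma hcvgD (u s : nat -> H) v w : hcvg u v -> hcvg s w ->
  hcvg (fun n => u n + s n) (v + w).
Proof.
move=> uv sw d d0; have e2 : 0 < d / 2 by rewrite divr_gt0.
have [n1 h1] := uv _ e2; have [n2 h2] := sw _ e2.
exists (maxn n1 n2) => n; rewrite geq_max => /andP[/h1 {}h1 /h2 {}h2].
rewrite opprD addrACA; apply: le_lt_trans (rnormD _ _) _.
by rewrite [ltRHS]splitr ltrD.
Qed.

(* The range of [A - i] is closed since [A - i] is bounded below, and its
   orthogonal complement is the eigenspace of [A] for [- i], which is zero. *)
Lemma resolvent_conj w : exists v, A (v, w + i *: v).
Proof.
pose M := [set w | exists v, A (v, w + i *: v)].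
have sM : subspace M.
  split; first by exists 0; rewrite scaler0 addr0; exact: sa_0.
  move=> a x y [x' hx] [y' hy]; exists (a *: x' + y').
  have := sa_lin a hx hy; congr (A (_, _)).
  by rewrite !scalerDr !scalerA (mulrC i) addrACA.
have cM : seq_closed M.
  move=> u v /choice[s hs] uv.
  have /hcauchy_cvg[y sy] : hcauchy s.
    move=> d d0; have e2 : 0 < d / 2 by rewrite divr_gt0.
    have [n0 hn] := uv _ e2; exists n0 => m n nm nn.
    have h := rnorm_subi (sa_B (hs m) (hs n)).
    apply: le_lt_trans (le_sq_rnorm h (sqr_ge0 _)) _.
    have -> : u m + i *: s m - (u n + i *: s n) - i *: (s m - s n) = u m - u n.
      by rewrite scalerBr opprD addrACA addrK.
    rewrite -(subrKA v); apply: le_lt_trans (rnormD _ _) _.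
    by rewrite (rnormBC v) [ltRHS]splitr ltrD// hn.
  by exists y; apply: (sa_closed hs sy); apply/hcvgD/hcvgZ.
have [x [v hv] hx] := orth_decomp w sM cM.
suff h0 : w - x = 0 by exists v; move/eqP: h0; rewrite subr_eq0 => /eqP ->.
set y := w - x in hx *.
have : A (y, (- i) *: y).
  apply: sa_intro => p q pq; apply/eqP; rewrite ipZr -subr_eq0.
  have : '[q - i *: p, y] = 0.
    by rewrite ipC hx ?conjc0//; exists p; rewrite subrK.
  rewrite ipBl ipZl => /eqP; congr (_ - _ * _ == 0).
  by apply/eqP; rewrite eq_complex/= oppr0 opprK !eqxx.
move/rnorm_addi; rewrite -scalerDl addNr scale0r rnorm0 expr0n/= => /esym/eqP.
by rewrite paddr_eq0 ?sqr_ge0// => /andP[_ /eqP]; move/eqP;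
  rewrite sqrf_eq0 => /eqP /rnorm_eq0.
Qed.

End SelfAdjoint.

(** * The resolvents at [- i] and [i] *)

Section CompactResolvent.
Variables (R : realType) (H : hilbertSpace R).
Implicit Types (v w x y : H).

Local Notation i := ('i%C : R[i]).

(** Precompactness gives a cluster point of the image sequence; approximation at arbitrarily late
    indices stands in for a convergent subsequence. *)
Lemma compact_cluster (K : H -> H) (u : nat -> H) : compact_operator K ->
  (forall n, N (u n) <= 1) ->
  exists y, forall (d : R) n0, 0 < d -> exists2 n, (n0 <= n)%N & N (K (u n) - y) < d.
Proof.
move=> [_]; rewrite precompactE => cK uN.
have [] := cK ((fun n => K (u n)) @ \oo) _.
  exists 0%N => // n _; apply: subset_closure; exists (u n) => //.
  exact: uN.
move=> y [_ cy]; exists y => d n0 d0.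
have [||z [[n n0n <-] /ball_rnorm h]] := cy [set K (u n) | n in [set n | (n0 <= n)%N]]
  (ball y d%:C%C).
- by exists n0 => // n /= n0n; exists n.
- by apply: nbhsx_ballx; rewrite ltcR.
- by exists n => //; rewrite rnormBC.
Qed.

Variables (A : set (H * H)) (saA : adjoint A = A).
Variables (K : H -> H) (cK : compact_operator K).
Hypothesis KA : op_inv (op_add A (fun v => i *: v)) = graph K.

Lemma resolventP w : A (K w, w - i *: K w).
Proof.
have : op_inv (op_add A (fun v => i *: v)) (w, K w) by rewrite KA.
by move=> [[p q] /= Apq [<- <-]]; rewrite addrK.
Qed.

Lemma resolventE v x : A (v, x) -> K (x + i *: v) = v.
Proof.
move=> h; have : graph K (x + i *: v, v) by rewrite -KA; exists (v, x).
by [].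
Qed.

Lemma resolvent_le w : N (K w) <= N w.
Proof.
have h := rnorm_addi saA (resolventP w).
by rewrite subrK in h; exact: le_sq_rnorm h (sqr_ge0 _).
Qed.

Lemma resolventB v w : K (v - w) = K v - K w.
Proof.
have h := sa_B saA (resolventP v) (resolventP w).
rewrite -(resolventE h); congr K.
by vec.
Qed.

Lemma resolventZ a v : K (a *: v) = a *: K v.
Proof.
have h := sa_Z saA a (resolventP v).
rewrite -(resolventE h); congr K.
by vec.
Qed.

(** [L] is [(A - i)^-1], the adjoint of [K]. By the resolvent identity [K L] and [L K] both equal
    [(L - K) / (2 i)], so [K] is normal and [|L v| = |K v|]. The last item says that eigenvectors of
    [A] are eigenvectors of [L]. *)
Lemma resolvent_pair : exists L : H -> H,
  [/\ forall w, A (L w, w + i *: L w),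
      forall v w, '[K v, w] = '[v, L w],
      forall v, N (L v) = N (K v) &
      forall l v, eigenvector A l v -> v = (l%:C%C - i) *: L v].
Proof.
have /choice[L AL] := resolvent_conj saA.
have Linj v x : A (v, x) -> L (x - i *: v) = v.
  move=> h; have := rnorm_subi saA (sa_B saA h (AL (x - i *: v))).
  move: (L _) => y; have -> : x - (x - i *: v + i *: y) - i *: (v - y) = 0 by vec.
  rewrite rnorm0 expr0n/= => /esym/eqP; rewrite paddr_eq0 ?sqr_ge0// => /andP[_].
  by rewrite sqrf_eq0 => /eqP /rnorm_eq0 /eqP; rewrite subr_eq0 => /eqP ->.
have adj v w : '[K v, w] = '[v, L w].
  have := sa_sym saA (resolventP v) (AL w).
  rewrite ipBl ipDr ipZl ipZr => /eqP; rewrite subr_eq => /eqP ->.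
  rewrite -addrA -mulrDl (_ : i^*%C + i = 0) ?mul0r ?addr0//.
  by apply/eqP; rewrite eq_complex/= addr0 addNr !eqxx.
have LZ a v : L (a *: v) = a *: L v.
  rewrite -(Linj _ _ (sa_Z saA a (AL v))); congr L.
  by rewrite scalerDr !scalerA (mulrC i) addrK.
have KL w : K (L w) = L (K w).
  have h := sa_B saA (AL w) (resolventP w).
  have h1 := resolventE h; have h2 := Linj _ _ h.
  have e1 : w + i *: L w - (w - i *: K w) + i *: (L w - K w) = (i + i) *: L w.
    by vec.
  have e2 : w + i *: L w - (w - i *: K w) - i *: (L w - K w) = (i + i) *: K w.
    by vec.
  rewrite e1 resolventZ in h1; rewrite e2 LZ -h1 in h2.
  have i0 : i + i != 0.
    by rewrite eq_complex/= addr0 eqxx/= -mulr2n mulrn_eq0/= oner_eq0.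
  by move/(congr1 (fun x => (i + i)^-1 *: x)): h2; rewrite !scalerA mulVf// !scale1r.
exists L; split => //.
  move=> v; apply/eqP; rewrite -(@eqrXn2 _ 2) ?rnorm_ge0// !rnorm_sqE.
  by rewrite -adj KL ipC -adj -ipC.
move=> l v; rewrite /eigenvector => h; rewrite -LZ -[LHS](Linj _ _ h).
by rewrite scalerBl.
Qed.

End CompactResolvent.

(** * Totality of the eigenvectors *)

Section EigenvectorExistence.
Variables (R : realType) (H : hilbertSpace R).
Implicit Types (v w x y : H).

Local Notation i := ('i%C : R[i]).

Variables (A : set (H * H)) (saA : adjoint A = A).
Variables (K : H -> H) (cK : compact_operator K).
Hypothesis KA : op_inv (op_add A (fun v => i *: v)) = graph K.

Lemma invr_small (d : R) : 0 < d -> exists n0, forall n : nat, (n0 <= n)%N ->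
  n.+1%:R^-1 < d.
Proof.
move=> d0; exists (Num.truncn d^-1) => n hn.
rewrite invf_plt ?posrE//; apply: lt_le_trans (truncnS_gt _) _.
by rewrite ler_nat.
Qed.

(* If [A^2 v = a^2 v] then [a v + A v] and [a v - A v] are eigenvectors or zero, and
   their sum is [2 a v]. *)
Lemma eigenvectors_sq (m : R) v : 0 < m -> v != 0 ->
  (exists v1, A (v, v1) /\ A (v1, (m^-1 - 1)%:C%C *: v)) ->
  ~ (forall u, eigenvectors A setT u -> '[v, u] = 0).
Proof.
move=> m0 v0 [v1 [h1 h2]] orth.
set c := m^-1 - 1 in h2.
have Nv : 0 < N v ^+ 2 by rewrite exprn_gt0// lt_def rnorm_neq0 ?rnorm_ge0.
have h3 : N v1 ^+ 2 = c * N v ^+ 2.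
  by rewrite !rnorm_sqE (sa_sym saA h1 h2) ipZr conjc_real ReZ.
have c0 : 0 <= c by rewrite -(pmulr_lge0 _ Nv) -h3 sqr_ge0.
pose a := Num.sqrt c.
have aa : a * a = c by rewrite -expr2 sqr_sqrtr.
have acc : a%:C%C * a%:C%C = c%:C%C by rewrite -rmorphM aa.
have e1 : '[v, a%:C%C *: v + v1] = 0.
  apply: orth; exists a => //; rewrite /eigenvector.
  have := sa_D saA (sa_Z saA a%:C%C h1) h2; congr (A (_, _)).
  by rewrite scalerDr scalerA acc addrC.
have e2 : '[v, a%:C%C *: v - v1] = 0.
  apply: orth; exists (- a) => //; rewrite /eigenvector.
  have := sa_B saA (sa_Z saA a%:C%C h1) h2; congr (A (_, _)).
  by rewrite rmorphN scaleNr scalerBr scalerA acc opprB.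
have a0 : a = 0.
  have : '[v, a%:C%C *: v + v1] + '[v, a%:C%C *: v - v1] = 0 by rewrite e1 e2 addr0.
  rewrite -ipDr addrACA subrr addr0 -scalerDl ipZr ipvv -rmorphD conjc_real -rmorphM.
  move=> [] /eqP; rewrite mulf_eq0 (gt_eqF Nv) orbF -mulr2n mulrn_eq0/= => /eqP.
  by [].
have cz : c = 0 by rewrite -aa a0 mulr0.
move/eqP: h3; rewrite cz mul0r sqrf_eq0 => /eqP/rnorm_eq0 v10.
have /ip_eq0 : '[v, v] = 0.
  by apply: orth; exists 0 => //; rewrite /eigenvector scale0r -v10.
by move/eqP: v0.
Qed.

(* On the complement [M] of the eigenvectors, with [m] the supremum of [|Kv|^2] over
   unit vectors, a maximizing sequence satisfies [K^* K u_n - m u_n -> 0]; compactness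
   of [K] then yields [v] in [M] with [K^* K v = m v]. *)
Lemma total_eigenvectors (sv : forall v w w', A (v, w) -> A (v, w') -> w = w') : total
  (eigenvectors A setT).
Proof.
move=> v0 hv0; apply: contrapT => /eqP v0n.
have [L [AL adj NL eigL]] := resolvent_pair saA KA.
pose M := [set v | forall u, eigenvectors A setT u -> '[v, u] = 0].
(* The adjoint [L] of [K] multiplies each eigenvector by a scalar, so [K] preserves the orthogonal
   complement of the eigenvectors. *)
have KM v : M v -> M (K v).
  move=> Mv u [l _ hu]; rewrite adj.
  have l0 : l%:C%C - i != 0 by rewrite eq_complex/= sub0r oppr_eq0 oner_eq0 andbF.
  have := eigL _ _ hu => /(congr1 (fun x => (l%:C%C - i)^-1 *: x)).
  by rewrite scalerA mulVf// scale1r => <-; rewrite ipZr Mv ?mulr0//; exists l.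
pose S := [set N (K v) ^+ 2 | v in [set v | M v /\ N v <= 1]].
have S0 : S !=set0.
  exists (N (K 0) ^+ 2), 0 => //; split; last by rewrite rnorm0.
  by move=> u _; rewrite ip0l.
have Sub : has_ubound S.
  exists 1 => _ [v [_ v1] <-]; rewrite expr_le1// ?rnorm_ge0//.
  exact: le_trans (resolvent_le saA KA _) v1.
pose m := sup S.
have Km v : M v -> N (K v) ^+ 2 <= m * N v ^+ 2.
  move=> Mv; have [->|vn0] := eqVneq v 0.
    by have := resolvent_le saA KA 0; rewrite !rnorm0 expr0n mulr0 => h;
      rewrite -[leRHS](expr0n _ 2) ler_sqr ?nnegrE ?rnorm_ge0.
  have Nv : 0 < N v by rewrite lt_def rnorm_neq0 ?rnorm_ge0.
  have : S (N (K ((N v)^-1%:C%C *: v)) ^+ 2).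
    exists ((N v)^-1%:C%C *: v) => //; split.
      by move=> u /Mv h; rewrite ipZl h mulr0.
    by rewrite rnormZR ger0_norm ?invr_ge0 ?rnorm_ge0// mulVf ?lexx// gt_eqF.
  move/(ub_le_sup Sub); rewrite (resolventZ saA KA) rnormZR exprMn.
  by rewrite real_normK ?num_real// exprVn mulrC ler_pdivrMr ?exprn_gt0.
have Mv0 : M v0 by [].
have Kinj v : v != 0 -> K v != 0.
  apply: contra_neq => Kv0; have := resolventP KA v; rewrite Kv0 scaler0 subr0.
  by move/sv; apply; exact: sa_0.
have m0 : 0 < m.
  have := Km _ Mv0; have : 0 < N (K v0) ^+ 2.
    by rewrite exprn_gt0// lt_def rnorm_ge0 rnorm_neq0// Kinj.
  move=> /lt_le_trans h /h; rewrite pmulr_lgt0//.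
  by rewrite exprn_gt0// lt_def rnorm_neq0 ?rnorm_ge0.
have /choice[u hu] : forall n : nat, exists u, [/\ M u, N u <= 1 & m - n.+1%:R^-1 < N
  (K u) ^+ 2].
  move=> n; have [|_ [x [Mx x1] <-] hx] := @sup_adherent _ S n.+1%:R^-1 _ (conj S0 Sub).
    by rewrite invr_gt0.
  by exists x.
have uN n : N (u n) <= 1 by case: (hu n).
have [y hy] := compact_cluster cK uN.
(* As [K (u n)] lies in [M], [|L K u|^2 <= m |K u|^2]; expanding the square then leaves at most
   [m (m - |K u|^2)]. *)
have approx n : N (L (K (u n)) - m%:C%C *: u n) ^+ 2 <= m * n.+1%:R^-1.
  have [Mu u1 hK] := hu n.
  rewrite rnorm_sqB rnormZR exprMn real_normK ?num_real// ipZr conjc_real ReZ.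
  have -> : Re '[L (K (u n)), u n] = N (K (u n)) ^+ 2.
    by rewrite ipC -adj -ipC -rnorm_sqE.
  have h1 : N (L (K (u n))) ^+ 2 <= m * N (K (u n)) ^+ 2 by rewrite NL Km//; exact: KM.
  have h2 : m ^+ 2 * N (u n) ^+ 2 <= m ^+ 2 * 1.
    by rewrite ler_wpM2l ?sqr_ge0// expr_le1 ?rnorm_ge0.
  have h3 : m * (m - N (K (u n)) ^+ 2) <= m * n.+1%:R^-1.
    by rewrite ler_wpM2l ?(ltW m0)//; move: hK; move: (_ ^-1) => p; lra.
  by move: h1 h2 h3; move: (_ ^-1) => p; nra.
(* [u n] is close to [m^-1 L K (u n)] and [K (u n)] clusters at [y], so [u n] clusters at
   [m^-1 L y]. *)
pose v := m^-1%:C%C *: L y.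
have mm : m^-1%:C%C * m%:C%C = 1 :> R[i] by rewrite -rmorphM mulVf ?gt_eqF.
have LB x z : L (x - z) = L x - L z.
  by apply: ip_ext => w; rewrite ipBl ![in '[L _, _]]ipC -!adj ipBr rmorphB.
have L_le x : N (L x) <= N x by rewrite NL; exact: (resolvent_le saA KA).
have approx' d : 0 < d -> exists n0, forall n, (n0 <= n)%N ->
    N (L (K (u n)) - m%:C%C *: u n) < d.
  move=> d0; have [|n0 hn] := @invr_small (d ^+ 2 / m).
    by rewrite divr_gt0// exprn_gt0.
  exists n0 => n /hn h; rewrite -ltr_sqr ?nnegrE ?rnorm_ge0 ?ltW//.
  by apply: le_lt_trans (approx n) _; rewrite mulrC -ltr_pdivlMr.
have near (d : R) n0 : 0 < d -> exists2 n, (n0 <= n)%N & N (u n - v) < d.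
  move=> d0; have md : 0 < m * d / 2 by rewrite !mulr_gt0.
  have [n1 hn1] := approx' _ md.
  have [n hn hKn] := hy _ (maxn n0 n1) md.
  move: hn; rewrite geq_max => /andP[n0n /hn1 h1]; exists n => //.
  have -> : u n - v = m^-1%:C%C *:
      ((m%:C%C *: u n - L (K (u n))) + L (K (u n) - y)).
    by rewrite LB subrKA scalerBr scalerA mm scale1r.
  rewrite rnormZR ger0_norm ?invr_ge0 ?(ltW m0)// mulrC ltr_pdivrMr//.
  apply: le_lt_trans (rnormD _ _) _; rewrite rnormBC.
  apply: le_lt_trans (lerD (lexx _) (L_le _)) _.
  by rewrite (mulrC d) [ltRHS]splitr ltrD.
have near' (k : nat) : exists n, (k <= n)%N /\ N (u n - v) < k.+1%:R^-1.
  have [|n kn h] := near k.+1%:R^-1 k; first by rewrite invr_gt0.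
  by exists n.
have /choice[s hs] := near'.
have us : hcvg (u \o s) v.
  move=> d /invr_small[n0 hn]; exists n0 => n /hn /= h.
  by case: (hs n) => _ /lt_trans; apply.
have LKv : L (K v) = m%:C%C *: v.
  apply/eqP; rewrite -subr_eq0; apply/eqP/rnorm_eq0.
  apply/eqP; rewrite eq_le rnorm_ge0 andbT; apply: le_eps => d d0.
  have d2 : 0 < d / 2 by rewrite divr_gt0.
  have [n0 hn0] := approx' _ d2.
  have d3 : 0 < d / 2 / (1 + m) by rewrite !divr_gt0// addr_gt0.
  have [n /hn0 h1 h2] := near _ n0 d3.
  have -> : L (K v) - m%:C%C *: v =
      (L (K (u n)) - m%:C%C *: u n) - (L (K (u n - v)) - m%:C%C *: (u n - v)).
    by rewrite (resolventB saA KA) LB; vec.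
  rewrite add0r [leRHS]splitr; apply: le_trans (rnormB _ _) _.
  rewrite lerD ?(ltW h1)//; apply: le_trans (rnormB _ _) _.
  rewrite rnormZR ger0_norm ?(ltW m0)//.
  apply: (@le_trans _ _ ((1 + m) * N (u n - v))).
    rewrite mulrDl mul1r lerD2r; apply: le_trans (L_le _) _.
    exact: (resolvent_le saA KA).
  by rewrite mulrC -ler_pdivlMr ?ltW// addr_gt0.
(* If [v] were zero, some late [u n] would be small, hence [K (u n)] too, although [|K (u n)|^2]
   tends to [m > 0]. *)
have vn0 : v != 0.
  apply/eqP => vz.
  have m2 : 0 < m / 2 by rewrite divr_gt0.
  have [n0 hn0] := invr_small m2.
  have sm : 0 < Num.sqrt (m / 2) by rewrite sqrtr_gt0.
  have [n /hn0 h1 h2] := near _ n0 sm; rewrite vz subr0 in h2.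
  have [_ _ h3] := hu n.
  have h4 : N (K (u n)) ^+ 2 < m / 2.
    rewrite -(sqr_sqrtr (ltW m2)) ltr_sqr ?nnegrE ?rnorm_ge0 ?sqrtr_ge0//.
    exact: le_lt_trans (resolvent_le saA KA _) h2.
  by move: h1 h3 h4; move: (_ ^-1) (N _ ^+ 2) => p q; lra.
(* [L K v = m v] means [(1 + A^2)^-1 v = m v], whence [A^2 v = (m^-1 - 1) v]. *)
apply: (eigenvectors_sq m0 vn0).
  have mm' : m%:C%C * m^-1%:C%C = 1 :> R[i] by rewrite mulrC.
  have h1 : A (v, m^-1%:C%C *: K v + i *: v).
    have := sa_Z saA m^-1%:C%C (AL (K v)); rewrite LKv; congr (A (_, _)).
      by rewrite scalerA mm scale1r.
    by rewrite scalerDr !scalerA mulrCA mm mulr1.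
  exists (m^-1%:C%C *: K v + i *: v); split => //.
  have := sa_D saA (sa_Z saA m^-1%:C%C (resolventP KA v)) (sa_Z saA i h1).
  have ii (z : H) : i *: (i *: z) = - z.
    by rewrite scalerA -[RHS]scaleN1r; congr (_ *: _); exact: sqr_i.
  by congr (A (_, _)); rewrite (scalerDr i) ii rmorphB; vec.
move=> w Ew; apply: (ip_lim_cst us) => n /=; have [Mu _ _] := hu (s n).
exact: Mu.
Qed.

End EigenvectorExistence.

(** * Countable eigenbases and discreteness of the spectrum *)

Section Eigenbasis.
Variables (R : realType) (H : hilbertSpace R).
Implicit Types (v w x y : H).

Local Notation i := ('i%C : R[i]).

Definition eigenbasis (A : set (H * H)) (L : set R) (e : nat -> H) (l : nat -> R) :=
  [/\ orthosys e, total (range e), forall n, eigenvector A (l n) (e n) &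
      forall n, e n != 0 -> L (l n)].

(** Orthonormal vectors are [sqrt 2] apart, so points of a countable dense set within [1/2] of them
    are distinct. *)
Lemma orthonormal_countable (S : set H) : separable H ->
  (forall v, S v -> N v = 1) ->
  (forall v w, S v -> S w -> v <> w -> '[v, w] = 0) ->
  exists f : H -> nat, {in S &, injective f}.
Proof.
move=> [D /countable_injP[f fD] dD] S1 So.
have /choice[d hd] : forall v, exists x, D x /\ N (v - x) < 2^-1.
  move=> v; have [||x [/ball_rnorm h Dx]] := dD (ball v (2^-1)%:C%C).
  - by exists v; apply: ballxx; rewrite ltcR invr_gt0.
  - exact: ball_open.
  - by exists x.
exists (f \o d) => v w /set_mem Sv /set_mem Sw /= /fD dvw.
have {}dvw : d v = d w by apply: dvw; apply/mem_set; [case: (hd v)|case: (hd w)].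
apply: contrapT => vw.
have h : N (v - w) ^+ 2 = 2 by rewrite rnorm_sqB So// !S1//= mulr0 subr0 expr1n.
have : N (v - w) < 1.
  rewrite -(subrKA (d v)) {2}dvw; apply: le_lt_trans (rnormD _ _) _.
  case: (hd v) => _ h1; case: (hd w) => _ h2; rewrite (rnormBC (d w)).
  by rewrite [ltRHS]splitr -[X in X + X]/(1 / 2) mul1r ltrD.
rewrite -ltr_sqr ?nnegrE ?rnorm_ge0// h expr1n; lra.
Qed.

Variables (A : set (H * H)) (saA : adjoint A = A).

Lemma eigenspace_subspace l : subspace (eigenvector A l).
Proof.
split; first by rewrite /eigenvector scaler0; exact: sa_0.
move=> a v w hv hw; have := sa_lin saA a hv hw; congr (A (_, _)).
by rewrite scalerDr !scalerA mulrC.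
Qed.

Lemma eigenspace_closed l : seq_closed (eigenvector A l).
Proof. by move=> u v hu uv; apply: (sa_closed saA hu uv); exact: hcvgZ. Qed.

Lemma eigenbasis_ex (L : set R) : separable H -> total (eigenvectors A L) ->
  exists e l, eigenbasis A L e l.
Proof.
move=> sepH tot.
pose P (S : set H) := [/\ S `<=` eigenvectors A L, forall v, S v -> N v = 1 &
  forall v w, S v -> S w -> v <> w -> '[v, w] = 0].
have [|S [[SE S1 So] Smax]] := @Zorn_bigcup _ P.
  move=> F FP Ft; split.
  - by move=> v [X FX Xv]; have [h _ _] := FP _ FX; exact: h.
  - by move=> v [X FX Xv]; have [_ h _] := FP _ FX; exact: h.
  - move=> v w [X FX Xv] [Y FY Yw].
    have [_ _ hX] := FP _ FX; have [_ _ hY] := FP _ FY.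
    by have [XY|YX] := Ft _ _ FX FY; [apply: hY => //; exact: XY | apply: hX => //;
      exact: YX].
have St : total S.
  move=> v Sv; apply: tot => u [l Ll lu].
  have [x lx hx] := orth_decomp v (eigenspace_subspace l) (@eigenspace_closed l).
  suff x0 : x = 0 by have := hx _ lu; rewrite x0 subr0.
  have xS s : S s -> '[x, s] = 0.
    move=> Ss; have [m Lm ms] := SE _ Ss.
    have [lm|lm] := eqVneq l m.
      by rewrite -[x](subKr v) ipBl Sv// hx ?subr0// lm.
    exact: eigen_orth lm lx ms.
  apply: contrapT => /eqP xn0.
  have Nx : 0 < N x by rewrite lt_def rnorm_neq0 ?rnorm_ge0.
  pose z := (N x)^-1%:C%C *: x.
  have Nz : N z = 1.
    by rewrite rnormZR ger0_norm ?invr_ge0 ?rnorm_ge0// mulVf// gt_eqF.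
  have zS s : S s -> '[z, s] = 0 by move=> /xS h; rewrite ipZl h mulr0.
  have nSz : ~ S z.
    by move=> /zS; rewrite ipvv Nz expr1n => -[] /eqP; rewrite oner_eq0.
  apply: (Smax (S `|` [set z])).
    split; first exact: subsetUl.
    by move=> /(_ z) h; apply: nSz; apply: h; right.
  split.
  - move=> s [/SE//|->]; exists l => //.
    have := (eigenspace_subspace l).2 (N x)^-1%:C%C _ _ lx (eigenspace_subspace l).1.
    by rewrite addr0.
  - by move=> s [/S1//|->].
  - move=> s t [Ss|->] [St|->] //; first exact: So.
    + by rewrite ipC zS// conjc0.
    + by rewrite zS.
have [f fS] := orthonormal_countable sepH S1 So.
(* Indices outside the image of [S] under [f] receive the default value, the zero vector. *)
pose e n := xget 0 [set v | S v /\ f v = n].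
have eP n : e n = 0 \/ (S (e n) /\ f (e n) = n).
  by rewrite /e; case: xgetP => [y _ [Sy fy]|_]; [right|left].
have /choice[l hl] : forall n, exists l, eigenvector A l (e n) /\ (e n != 0 -> L l).
  move=> n; have [->|[/SE[l Ll lu] _]] := eP n; last by exists l.
  exists 0; split; last by rewrite eqxx.
  by rewrite /eigenvector scaler0; exact: sa_0.
exists e, l; split.
- split.
    by move=> n; have [->|[/S1 ? _]] := eP n; [left|right].
  move=> m n mn; have [->|[Sm fm]] := eP m; first by rewrite ip0l.
  have [->|[Sn fn]] := eP n; first by rewrite ip0r.
  by apply: So => // emn; move: mn; rewrite -fm -fn emn eqxx.
- move=> v hv; apply: St => s Ss; apply: hv; exists (f s) => //.
  have [Sn fn] : S (e (f s)) /\ f (e (f s)) = f s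
    by apply: (@xgetI _ 0 [set v | S v /\ f v = f s] s).
  by apply: fS => //; exact/mem_set.
- by move=> n; case: (hl n).
- by move=> n; case: (hl n).
Qed.

(** Infinitely many eigenvalues in [(-r, r)] would give orthogonal vectors [K (e n)] of squared norm
    at least [1 / (1 + r^2)], and such a sequence has no cluster point. *)
Lemma eigenbasis_discrete (K : H -> H) L e l (r : R) : compact_operator K ->
  op_inv (op_add A (fun v => i *: v)) = graph K -> eigenbasis A L e l ->
  exists n0, forall n, (n0 <= n)%N -> e n != 0 -> r <= `|l n|.
Proof.
move=> cK KA [oe te el _]; apply: contrapT => noex.
have /choice[g hg] : forall n0, exists n, [/\ (n0 <= n)%N, e n != 0 & `|l n| < r].
  move=> n0; apply: contrapT => no; apply: noex; exists n0 => n nn en.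
  by rewrite leNgt; apply/negP => h; apply: no; exists n.
have N1 n : e n != 0 -> N (e n) = 1 by case: (oe.1 n) => // ->; rewrite eqxx.
have [|y hy] := compact_cluster (u := e \o g) cK.
  by move=> n; case: (hg n) => _ /N1 /= -> _.
have Ke n : K (e n) = ((l n)%:C%C + i)^-1 *: e n.
  have l0 : (l n)%:C%C + i != 0 by rewrite eq_complex/= add0r oner_eq0 andbF.
  have := resolventE KA (el n); rewrite -scalerDl (resolventZ saA KA).
  move/(congr1 (fun x => ((l n)%:C%C + i)^-1 *: x)).
  by rewrite scalerA mulVf// scale1r.
have Kn n : e n != 0 -> `|l n| < r -> (1 + r ^+ 2)^-1 <= N (K (e n)) ^+ 2.
  move=> /N1 en ln; rewrite Ke rnormZ en mulr1.
  rewrite ComplexField.Normc.normcV exprVn ncE/= addr0 add0r expr1n.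
  have p1 : 0 < 1 + r ^+ 2 by rewrite ltr_pwDl ?sqr_ge0.
  have p2 : 0 < l n ^+ 2 + 1 by rewrite ltr_wpDl ?sqr_ge0.
  rewrite lef_pV2 ?posrE// addrC lerD2l.
  by rewrite -real_normK ?num_real// ler_sqr ?nnegrE ?(ltW ln)// (le_trans _ (ltW ln)).
pose d := (1 + r ^+ 2)^-1.
have d0 : 0 < d by rewrite invr_gt0 ltr_pwDl ?sqr_ge0.
have sd : 0 < Num.sqrt d / 2 by rewrite divr_gt0// sqrtr_gt0.
(* Searching from [(g n1).+1] forces [g n1 < g n2]. Both images lie within [sqrt d / 2] of [y], but
   their squared distance is at least [2 d]. *)
have [n1 _ h1] := hy _ 0%N sd; have [n2 n12 h2] := hy _ (g n1).+1 sd.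
have [_ e1 l1] := hg n1; have [gn2 e2 l2] := hg n2.
have lt12 : (g n1 < g n2)%N by exact: leq_trans n12 gn2.
have : N (K (e (g n1)) - K (e (g n2))) < Num.sqrt d.
  rewrite -(subrKA y); apply: le_lt_trans (rnormD _ _) _.
  by rewrite (rnormBC y) [ltRHS]splitr ltrD.
rewrite -ltr_sqr ?nnegrE ?rnorm_ge0 ?sqrtr_ge0// sqr_sqrtr ?(ltW d0)//.
have -> : N (K (e (g n1)) - K (e (g n2))) ^+ 2 = N (K (e (g n1))) ^+ 2 + N (K (e (g
  n2))) ^+ 2.
  rewrite rnorm_sqB; have -> : '[K (e (g n1)), K (e (g n2))] = 0.
    by rewrite !Ke ipZl ipZr oe.2 ?mulr0// neq_ltn lt12.
  by rewrite mulr0 subr0.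
have := Kn _ e1 l1; have := Kn _ e2 l2; rewrite -/d; move: (_ ^+ 2) (_ ^+ 2) => p q;
  lra.
Qed.

End Eigenbasis.

(** * Functional calculus in an eigenbasis *)

Section BoundedOperators.
Variables (R : realType) (H : hilbertSpace R).
Implicit Types (v w x y : H) (T : H -> H).

(** Explicit bounds are carried instead of [opnorm], whose supremum is meaningful only once some
    bound is known. *)
Definition bounded_by T (M : R) := forall v, N (T v) <= M * N v.

Lemma bounded_operator_intro T (M : R) : linear T -> bounded_by T M -> bounded_operator
  T.
Proof.
move=> lT bT; split => // v; apply/cvg_ballP => d d0.
have dR : d = (complex.Re d)%:C%C by rewrite RRe_real// gtr0_real.
have d0' : 0 < complex.Re d by rewrite -ltcR -dR.
have M1 : 0 < 1 + `|M| by rewrite ltr_pwDl.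
have e0 : 0 < (complex.Re d / (1 + `|M|))%:C%C :> R[i] by rewrite ltcR divr_gt0.
apply: filterS (nbhsx_ballx v _ e0) => w /ball_rnorm h.
rewrite dR; apply/ball_rnorm.
have -> : T v - T w = T (v - w).
  by rewrite [v - w]addrC -(scaleN1r w) lT scaleN1r addrC.
apply: le_lt_trans (bT _) _.
apply: (@le_lt_trans _ _ ((1 + `|M|) * N (v - w))).
  rewrite ler_wpM2r ?rnorm_ge0//; apply: le_trans (ler_norm _) _.
  by rewrite lerDr.
by rewrite mulrC -ltr_pdivlMr.
Qed.

Lemma opnorm_le T (M : R) : 0 <= M -> bounded_by T M -> opnorm T <= M.
Proof.
move=> M0 bT; apply: ge_sup.
  by exists (N (T 0)), 0 => //=; rewrite rnorm0.
move=> _ [v /= v1 <-]; apply: le_trans (bT v) _.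
by rewrite -[leRHS]mulr1 ler_wpM2l.
Qed.

Lemma le_opnorm T (M : R) : (forall a v, T (a *: v) = a *: T v) -> bounded_by T M ->
  bounded_by T (opnorm T).
Proof.
move=> TZ bT v; have [->|v0] := eqVneq v 0.
  by have := TZ 0 0; rewrite !scale0r => ->; rewrite rnorm0 mulr0.
have Nv : 0 < N v by rewrite lt_def rnorm_neq0 ?rnorm_ge0.
pose z := (N v)^-1%:C%C *: v.
have Nz : N z = 1.
  by rewrite rnormZR ger0_norm ?invr_ge0 ?rnorm_ge0// mulVf// gt_eqF.
have : N (T z) <= opnorm T.
  apply: ub_le_sup; last by exists z => //=; rewrite Nz.
  exists `|M| => _ [w /= w1 <-]; apply: le_trans (bT w) _.
  apply: le_trans (ler_wpM2r (rnorm_ge0 _) (ler_norm M)) _.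
  by rewrite -[leRHS]mulr1 ler_wpM2l.
rewrite TZ rnormZR ger0_norm ?invr_ge0 ?rnorm_ge0// mulrC.
by rewrite ler_pdivrMr.
Qed.

Lemma selfadjoint_idem_bounded T : (forall u v, '[T u, v] = '[u, T v]) ->
  (forall v, T (T v) = T v) -> bounded_by T 1.
Proof.
move=> sT iT v; rewrite mul1r.
have h : N (T v) ^+ 2 <= N (T v) * N v.
  rewrite rnorm_sqE sT iT ipC ReJ; apply: le_trans (ler_norm _) _.
  exact: le_trans (Re_le_nc _) (CauchySchwarz _ _).
have [->|n0] := eqVneq (N (T v)) 0; first exact: rnorm_ge0.
by move: h; rewrite expr2 ler_pM2l// lt_def n0 rnorm_ge0.
Qed.

End BoundedOperators.

Section FunctionalCalculus.
Variables (R : realType) (H : hilbertSpace R).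
Implicit Types (v w x y : H).

(** Both inner products are limits of the same partial sums, so identities between them reduce to
    identities between coefficients. *)
Lemma parseval_ext (e : nat -> H) : orthosys e -> total (range e) -> forall v w x y,
  (forall n, '[v, e n] * '[w, e n]^*%C = '[x, e n] * '[y, e n]^*%C) ->
  '[v, w] = '[x, y].
Proof.
move=> oe te v w x y h.
have hv := psum_cvg oe te v; have hx := psum_cvg oe te x.
apply: (ip_lim hv) => d /(ip_cvgr y hx)[n0 hn]; exists n0 => n /hn.
rewrite -ncJ rmorphB/= -!ipC; congr (nc (_ - _) < _).
by rewrite !ip_psum; apply: eq_bigr => k _.
Qed.

Definition bddfun (p : R -> R) := exists M, forall t, `|p t| <= M.

(* The operator [p(A)], for [A] diagonal in the basis [e] with eigenvalues [l]; the
   junk value [0] does not occur when [p] is bounded. *)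
Definition fcalc (e : nat -> H) (l : nat -> R) (p : R -> R) v : H :=
  xget 0 [set w | forall n, '[w, e n] = (p (l n))%:C%C * '[v, e n]].

Variables (A : set (H * H)) (saA : adjoint A = A).
Variables (L : set R) (e : nat -> H) (l : nat -> R) (eb : eigenbasis A L e l).

(** [A] is the maximal diagonal operator: a pair with diagonal coefficients is symmetric against the
    whole graph by Parseval, hence belongs to [adjoint A = A]. *)
Lemma eigenbasis_graph v w : A (v, w) <-> forall n, '[w, e n] = (l n)%:C%C * '[v, e n].
Proof.
case: eb => [oe te el _]; split=> [h n|h].
  by have := sa_sym saA h (el n); rewrite ipZr conjc_real.
apply: sa_intro => // p q pq.
apply: (parseval_ext oe te) => n.
by rewrite h (sa_sym saA pq (el n)) ipZr conjM !conjc_real; ring.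
Qed.

Lemma fcalcE p v n : bddfun p -> '[fcalc e l p v, e n] = (p (l n))%:C%C * '[v, e n].
Proof.
case: eb => [oe te el _] [M pM]; rewrite /fcalc; case: xgetP => [w _ //|no].
have [|w hw] := @diag_ex _ _ _ oe (p \o l) M v _ (fun n _ => pM (l n)).
  exact: le_trans (normr_ge0 _) (pM 0).
by have := no w.
Qed.

Lemma fcalc_uniq p v w : bddfun p -> (forall n, '[w, e n] = (p (l n))%:C%C * '[v, e n])
  ->
  fcalc e l p v = w.
Proof.
by case: eb => [oe te _ _] bp h; apply: (total_eq te) => n; rewrite fcalcE.
Qed.

Lemma fcalc_linear p : bddfun p -> linear (fcalc e l p).
Proof.
move=> bp a v w; apply: fcalc_uniq => // n.
by rewrite !ipDl !ipZl !fcalcE//; ring.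
Qed.

Lemma fcalcZ p a v : bddfun p -> fcalc e l p (a *: v) = a *: fcalc e l p v.
Proof. by move=> bp; apply: fcalc_uniq => // n; rewrite !ipZl fcalcE// mulrCA. Qed.

Lemma fcalcB p v w : bddfun p -> fcalc e l p (v - w) = fcalc e l p v - fcalc e l p w.
Proof. by move=> bp; apply: fcalc_uniq => // n; rewrite !ipBl !fcalcE// mulrBr. Qed.

Lemma fcalc_bounded p M : (forall t, `|p t| <= M) -> bounded_by (fcalc e l p) M.
Proof.
case: eb => [oe te _ _] pM v; apply: (coef_le oe te).
  exact: le_trans (normr_ge0 _) (pM 0).
move=> n; rewrite fcalcE; last by exists M.
by rewrite ComplexField.Normc.normcM ncR ler_wpM2r// nc_ge0.
Qed.

Lemma fcalc_bounded_on p M : bddfun p -> 0 <= M -> (forall n, e n != 0 -> `|p (l n)| <=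
  M) ->
  bounded_by (fcalc e l p) M.
Proof.
case: eb => [oe te _ _] bp M0 pM v; apply: (coef_le oe te) => //.
move=> n; rewrite fcalcE// ComplexField.Normc.normcM ncR.
have [->|/pM h] := eqVneq (e n) 0; first by rewrite ip0r nc0 !mulr0.
by rewrite ler_wpM2r// nc_ge0.
Qed.

Lemma eigen_coef m v n : eigenvector A m v -> m != l n -> '[v, e n] = 0.
Proof. by case: eb => [_ _ el _] h ml; exact: eigen_orth ml h (el n). Qed.

Lemma fcalc_eigen p m v : bddfun p -> eigenvector A m v -> fcalc e l p v = (p m)%:C%C
  *: v.
Proof.
move=> bp Av; apply: fcalc_uniq => // n; rewrite ipZl.
have [->//|ml] := eqVneq m (l n).
by rewrite (eigen_coef Av ml) !mulr0.
Qed.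

Lemma fcalc_sym p v w : bddfun p -> '[fcalc e l p v, w] = '[v, fcalc e l p w].
Proof.
case: eb => [oe te _ _] bp; apply: (parseval_ext oe te) => n; rewrite !fcalcE//.
by rewrite conjM conjc_real; ring.
Qed.

Lemma fcalcM p q v : bddfun p -> bddfun q ->
  fcalc e l (fun t => p t * q t) v = fcalc e l p (fcalc e l q v).
Proof.
move=> bp bq; have [M pM] := bp; have [M' qM] := bq.
apply: fcalc_uniq => //.
  by exists (M * M') => t; rewrite normrM ler_pM.
by move=> n; rewrite !fcalcE// rmorphM mulrA.
Qed.

Lemma fcalc_selfadjoint p : bddfun p -> bounded_selfadjoint (fcalc e l p).
Proof.
move=> bp; have [M pM] := bp; split; last by move=> u v; exact: fcalc_sym.
by apply: bounded_operator_intro (fcalc_linear bp) (fcalc_bounded pM).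
Qed.

End FunctionalCalculus.

(** * Spectral measures *)

Section SumOfDiracs.
Variables (R : realType).

Lemma eseries_cvg (a : nat -> R) s : (forall n, 0 <= a n) ->
  \sum_(0 <= i < K) a i @[K --> \oo] --> s -> (\sum_(n <oo) (a n)%:E = s%:E)%E.
Proof.
move=> a0 as_; apply/cvg_lim => //.
under eq_cvg do rewrite sumEFin.
by apply: cvg_EFin => //; exact: nearW.
Qed.

Lemma sum_bounded_cvg (a : nat -> R) M : (forall n, 0 <= a n) ->
  (forall K, \sum_(0 <= i < K) a i <= M) ->
  exists s : R, \sum_(0 <= i < K) a i @[K --> \oo] --> s.
Proof.
move=> a0 aM; pose s (K : nat) : R := \sum_(0 <= i < K) a i.
suff /cvg_ex : cvg (s @ \oo) by [].
apply: nondecreasing_is_cvgn.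
  by apply/nondecreasing_seqP => n; rewrite /s big_nat_recr//= lerDl.
by exists M => _ [n _ <-]; exact: aM.
Qed.

Lemma eseries_lty (a : nat -> R) : (forall n, 0 <= a n) ->
  (\sum_(n <oo) (a n)%:E < +oo)%E -> exists M, forall K, \sum_(0 <= i < K) a i <= M.
Proof.
move=> a0 h; exists (fine (\sum_(n <oo) (a n)%:E)%E) => K.
rewrite -lee_fin fineK; last first.
  by rewrite ge0_fin_numE//; apply: nneseries_ge0 => n _ _; rewrite lee_fin.
rewrite -sumEFin; apply: nneseries_lim_ge => n _ _; by rewrite lee_fin.
Qed.

Variables (c : nat -> R) (c0 : forall n, 0 <= c n) (l : nat -> R).

(** With [c n = |<v, e n>|^2] and [l n] the eigenvalues, this is the scalar spectral measure of
    [v]. *)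
Definition diracs : {measure set R -> \bar R} :=
  mseries (fun n => mscale (NngNum (c0 n)) \d_(l n)) 0.

Lemma diracsE (S : set R) : diracs S = (\sum_(n <oo) (c n * \1_S (l n))%:E)%E.
Proof. by apply: eq_eseriesr => n _. Qed.

Lemma integral_diracs (f : R -> R) : measurable_fun setT f -> (forall t, 0 <= f t) ->
  (\int[diracs]_t (f t)%:E = \sum_(n <oo) (c n * f (l n))%:E)%E.
Proof.
move=> mf f0; have /measurable_EFinP mF := mf.
rewrite ge0_integral_measure_series//; last by move=> t _; rewrite lee_fin.
apply: eq_eseriesr => n _.
rewrite ge0_integral_mscale//; last by move=> t _; rewrite lee_fin.
by rewrite integral_dirac// diracT mul1e.
Qed.

End SumOfDiracs.

Section SpectralMeasure.
Variables (R : realType) (H : hilbertSpace R).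
Implicit Types (v w x y : H).

Lemma bdd_indic (S : set R) : bddfun (\1_S : R -> R).
Proof. by exists 1 => t; rewrite indicE; case: (_ \in _); rewrite ?normr1// normr0. Qed.

Variables (A : set (H * H)) (saA : adjoint A = A).
Variables (L : set R) (e : nat -> H) (l : nat -> R) (eb : eigenbasis A L e l).

Lemma fcalc_projection (S : set R) : orthogonal_projection (fcalc e l \1_S).
Proof.
split; first exact: (fcalc_selfadjoint eb (bdd_indic S)).
move=> v; rewrite -(fcalcM eb); try exact: bdd_indic; congr (fcalc e l _ v).
by apply/funext => t; rewrite !indicE; case: (_ \in _); rewrite ?mulr1 ?mulr0.
Qed.

Lemma Re_ip_coef p v w n : '[w, e n] = p%:C%C * '[v, e n] ->
  Re ('[w, e n] * '[v, e n]^*%C) = nc '[v, e n] ^+ 2 * p.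
Proof. by move=> ->; rewrite -mulrA mul_conj -rmorphM/= mulrC. Qed.

(** By existence, the choice in [spectral_projection] is a genuine spectral measure and not the
    default. The domain condition becomes the convergence of the series of [l n ^ 2 |<v, e n>|^2],
    with Bessel for one direction and Riesz-Fischer for the other. *)
Lemma spectral_measure_ex : is_spectral_measure A (fun S => fcalc e l \1_S).
Proof.
case: (eb) => [oe te el _]; split.
- by move=> S _; exact: fcalc_projection.
- apply/funext => v; apply: (fcalc_uniq eb); first exact: bdd_indic.
  by move=> n; rewrite indicT mul1r.
- move=> S S' _ _; apply/funext => v /=.
  rewrite -(fcalcM eb); try exact: bdd_indic; congr (fcalc e l _ v).
  by rewrite indicI.
move=> v; pose c n := nc '[v, e n] ^+ 2.
have c0 n : 0 <= c n by exact: sqr_ge0.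
exists (diracs c0 l); split.
- move=> S _; rewrite diracsE; apply: eseries_cvg.
    by move=> n; rewrite mulr_ge0// indicE.
  have := parseval oe te (v := fcalc e l \1_S v) (w := v).
  apply: cvg_trans; apply: near_eq_cvg; apply: nearW => K /=.
  apply: eq_bigr => n _; rewrite (@Re_ip_coef (\1_S (l n)))//.
  by apply: (fcalcE eb); exact: bdd_indic.
- rewrite integral_diracs; last 2 first.
  + by apply: measurable_funX; exact: measurable_id.
  + by move=> t; exact: sqr_ge0.
  have cl0 n : 0 <= c n * l n ^+ 2 by rewrite mulr_ge0// sqr_ge0.
  have cE w n : '[w, e n] = (l n)%:C%C * '[v, e n] -> nc '[w, e n] ^+ 2 = c n * l n ^+
    2.
    move=> ->; rewrite ComplexField.Normc.normcM exprMn ncR real_normK ?num_real//.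
    by rewrite mulrC.
  split=> [[w /(eigenbasis_graph saA eb) h]|/(eseries_lty cl0)[M hM]].
    have [|s hs] := @sum_bounded_cvg _ (fun n => c n * l n ^+ 2) (N w ^+ 2) cl0.
      move=> K; apply: le_trans (bessel oe w K).
      by rewrite le_eqVlt; apply/orP; left; apply/eqP/eq_bigr => n _; rewrite cE.
    by rewrite (eseries_cvg cl0 hs) ltry.
  have [||w [_ hw _]] := @riesz_fischer _ _ _ oe (fun n => (l n)%:C%C * '[v, e n]) M.
  + by move=> n ->; rewrite ip0r mulr0.
  + move=> K; apply: le_trans (hM K); rewrite le_eqVlt; apply/orP; left.
    apply/eqP/eq_bigr => n _; rewrite ComplexField.Normc.normcM exprMn ncR.
    by rewrite real_normK ?num_real// mulrC.
  by exists w; apply/(eigenbasis_graph saA eb).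
move=> w Avw; have hw := (eigenbasis_graph saA eb _ _).1 Avw.
have wr : '[w, v] = (Re '[w, v])%:C%C.
  by have := ip_real saA Avw; case: ('[w, v]) => a b /= ->.
rewrite {}wr; congr (_%:C%C).
(* The positive and negative parts of [t] are at most [1 + t^2], so their sums against [c] are
   bounded by [|w|^2 + |v|^2] with [w = A v]; the integral of [t] is the difference of the two
   limits. *)
pose M := N w ^+ 2 + N v ^+ 2.
have sb (p : R -> R) : (forall t, 0 <= p t <= 1 + t ^+ 2) ->
    exists s : R, \sum_(0 <= n < K) (c n * p (l n)) @[K --> \oo] --> s.
  move=> hp; apply: (@sum_bounded_cvg _ _ M) => [n|K].
    by rewrite mulr_ge0//; case/andP: (hp (l n)).
  apply: le_trans (lerD (bessel oe w K) (bessel oe v K)).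
  rewrite -big_split/=; apply: ler_sum => n _.
  rewrite hw ComplexField.Normc.normcM exprMn ncR real_normK ?num_real// -/(c n).
  rewrite -[X in _ <= _ + X]mulr1 (mulrC (l n ^+ 2)) -mulrDr addrC ler_wpM2l//.
  by case/andP: (hp (l n)).
have max0 (t : R) : 0 <= Num.max t 0 <= 1 + t ^+ 2.
  by rewrite le_max lexx orbT/= ge_max addr_ge0 ?sqr_ge0// andbT; nra.
have [s1 h1] := sb (fun t => Num.max t 0) max0.
have [|s2 h2] := sb (fun t => Num.max (- t) 0).
  by move=> t; rewrite -(sqrrN t).
have Rew : Re '[w, v] = s1 - s2.
  have hA := parseval oe te (v := w) (w := v).
  suff hC : \sum_(0 <= i < K) Re ('[w, e i] * '[v, e i]^*%C) @[K --> \oo] --> s1 - s2.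
    exact: (cvg_unique (@norm_hausdorff _ _) hA hC).
  rewrite (_ : (fun K => _) = (fun K => \sum_(0 <= n < K) (c n * Num.max (l n) 0) -
      \sum_(0 <= n < K) (c n * Num.max (- l n) 0))); first exact: cvgB h1 h2.
  apply/funext => K.
  rewrite -sumrB; apply: eq_bigr => n _; rewrite (@Re_ip_coef (l n))//.
  rewrite -mulrBr; congr (_ * _).
  by rewrite !maxEle oppr_le0; case: (leP (l n) 0) => h1';
    case: (leP 0 (l n)) => h2'; lra.
have m1 : measurable_fun setT (fun t : R => Num.max t 0).
  by apply: measurable_maxr.
have m2 : measurable_fun setT (fun t : R => Num.max (- t) 0).
  by apply: measurable_maxr.
have p1 t : 0 <= Num.max t 0 :> R by rewrite le_max lexx orbT.
have p2 t : 0 <= Num.max (- t) 0 :> R by rewrite le_max lexx orbT.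
have i1 := integral_diracs c0 l m1 p1; have i2 := integral_diracs c0 l m2 p2.
rewrite (eseries_cvg _ h1) in i1; last by move=> n; rewrite mulr_ge0.
rewrite (eseries_cvg _ h2) in i2; last by move=> n; rewrite mulr_ge0.
rewrite Rew /Rintegral integralE.
rewrite [X in (X - _)%E](_ : _ = s1%:E); last first.
  by rewrite -i1; apply: eq_integral => t _; rewrite funeposE EFin_max.
rewrite [X in (_ - X)%E](_ : _ = s2%:E); last first.
  by rewrite -i2; apply: eq_integral => t _; rewrite funenegE EFin_max.
by [].
Qed.

End SpectralMeasure.

(** * Uniqueness of the spectral measure *)

Section MeasureConcentration.
Variables (R : realType) (mu : {measure set R -> \bar R}).

Lemma sq_integrable_id : (mu setT < +oo)%E -> (\int[mu]_t (t ^+ 2)%:E < +oo)%E ->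
  mu.-integrable setT (EFin \o (fun t : R => t)).
Proof.
move=> fmu f2.
have m2 : measurable_fun setT (fun t : R => t ^+ 2) by apply: measurable_funX.
have i2 : mu.-integrable setT (fun t => (t ^+ 2)%:E).
  apply/integrableP; split; first exact/measurable_EFinP.
  under eq_integral do rewrite gee0_abs ?lee_fin ?sqr_ge0//.
  by [].
have i1 : mu.-integrable setT (EFin \o cst (1 : R)).
  apply/integrableP; split; first exact/measurable_EFinP.
  under eq_integral do rewrite /= normr1.
  by rewrite integral_cst// mul1e.
have := integrableD measurableT i1 i2; apply: le_integrable => //.
  exact/measurable_EFinP.
move=> t _ /=; rewrite lee_fin [leRHS]ger0_norm ?addr_ge0 ?sqr_ge0//.
by rewrite ler_norml; nra.
Qed.

(** The function [s (t - m)] has integral zero and is nonnegative almost everywhere, so it vanishes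
    almost everywhere; being positive on [S], it makes [S] null. The sign of [s] selects the side of
    [m]. *)
Lemma mean_concentration (m s : R) (S : set R) : (mu setT < +oo)%E ->
  (\int[mu]_t (t ^+ 2)%:E < +oo)%E ->
  (\int[mu]_t t)%R = m * fine (mu setT) ->
  measurable S -> (forall t, S t -> 0 < s * (t - m)) -> mu (~` S) = 0%E ->
  mu S = 0%E.
Proof.
move=> fmu f2 mean mS Spos muS.
have i1 := sq_integrable_id fmu f2.
have i0 : mu.-integrable setT (EFin \o cst m).
  apply/integrableP; split; first exact/measurable_EFinP.
  under eq_integral do rewrite /=.
  by rewrite integral_cst// lte_mul_pinfty// lee_fin.
have i : mu.-integrable setT (EFin \o (fun t => t - m)).
  have := integrableB measurableT i1 i0.
  by apply: eq_integrable.
have z : (\int[mu]_t (t - m))%R = 0.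
  by rewrite RintegralB// mean Rintegral_cst// subrr.
have mf : measurable_fun setT (EFin \o (fun t => s * (t - m))).
  apply/measurable_EFinP; apply: measurable_funM => //.
  exact: measurable_funB.
have z' : (\int[mu]_t (s * (t - m))%:E = 0)%E.
  have h : (\int[mu]_t (s * (t - m)))%R = 0 by rewrite RintegralZl// z mulr0.
  have hf : (\int[mu]_t (s * (t - m))%:E)%E \is a fin_num.
    apply: integrable_fin_num => //.
    have := integrableZl measurableT s i.
    by apply: eq_integrable.
  by rewrite -(fineK hf); congr (_%:E).
have abs0 : (\int[mu]_(t in setT) `|(s * (t - m))%:E| = 0)%E.
  rewrite -[RHS]z'; apply: ae_eq_integral => //.
    exact: measurableT_comp.
  exists (~` S); split => //; first exact: measurableC.
  move=> t /= ht St; apply: ht => _.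
  by rewrite ger0_norm// ltW// Spos.
have [N [mN N0 sub]] := (ae_eq_integral_abs mu measurableT mf).1 abs0.
apply/eqP; rewrite eq_le measure_ge0 andbT -N0; apply: le_measure; rewrite ?inE//.
move=> t St; apply: sub => /= /(_ Logic.I) /= [] /eqP.
by rewrite gt_eqF// Spos.
Qed.

End MeasureConcentration.

Section SpectralMeasureUnique.
Variables (R : realType) (H : hilbertSpace R).
Implicit Types (u v w x y : H).

Variables (A : set (H * H)) (saA : adjoint A = A).
Variables (E : set R -> H -> H) (sE : is_spectral_measure A E).

Lemma spectral_linear S : measurable S -> linear (E S).
Proof. by case: sE => h _ _ _ /h[[[]]]. Qed.

Lemma spectral_sym S v w : measurable S -> '[E S v, w] = '[v, E S w].
Proof. by case: sE => h _ _ _ /h[[_]]. Qed.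

Lemma spectral_idem S v : measurable S -> E S (E S v) = E S v.
Proof. by case: sE => h _ _ _ /h[_]. Qed.

Lemma spectralI S S' v : measurable S -> measurable S' ->
  E S (E S' v) = E (S `&` S') v.
Proof. by case: sE => _ _ h _ mS mS'; rewrite h. Qed.

Lemma spectralC S S' v : measurable S -> measurable S' ->
  E S (E S' v) = E S' (E S v).
Proof. by move=> mS mS'; rewrite !spectralI// setIC. Qed.

Lemma spectralB S v w : measurable S -> E S (v - w) = E S v - E S w.
Proof.
by move=> mS; rewrite [v - w]addrC -(scaleN1r w) spectral_linear// scaleN1r addrC.
Qed.

Lemma spectral_norm S v : measurable S -> Re '[E S v, v] = N (E S v) ^+ 2.
Proof. by move=> mS; rewrite rnorm_sqE -spectral_sym// spectral_idem. Qed.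

Lemma spectralT v : E setT v = v.
Proof. by case: sE => _ -> _ _. Qed.

(* [u' = u - 2 E(S) u] has the same scalar spectral measure as [u], so it lies in the
   domain and has the same mean [m]; by polarization the spectral measure of [E(S) u],
   which is carried by [S], has mean [m] too. *)
Lemma spectral_side (m s : R) (S : set R) u : eigenvector A m u ->
  measurable S -> (forall t, S t -> 0 < s * (t - m)) -> E S u = 0.
Proof.
move=> Au mS Spos.
pose u1 := E S u; pose u' := u - (u1 + u1).
have [_ _ _ sc] := sE.
have [mu [muE mudom muint]] := sc u.
have [mu' [mu'E mu'dom mu'int]] := sc u'.
have [mu1 [mu1E mu1dom mu1int]] := sc u1.
have eqmu S' : measurable S' -> S' `<=` setT -> mu' S' = mu S'.
  move=> mS' _; rewrite muE// mu'E//; congr (_%:E).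
  have hE : E S' u' = E S' u - (E S' u1 + E S' u1).
    rewrite /u' spectralB//; congr (_ - _).
    by have := spectral_linear mS' 1 u1 u1; rewrite !scale1r.
  have h1 : '[E S' u1, u1] = '[E S' u1, u].
    by rewrite {2}/u1 -spectral_sym// spectralC// /u1 spectral_idem.
  have h2 : '[E S' u, u1] = '[E S' u1, u].
    by rewrite {1}/u1 -spectral_sym// spectralC.
  rewrite hE /u' !(ipBl, ipBr, ipDl, ipDr) h1 h2; congr (Re _); ring.
have Du' : dom A u'.
  apply/mu'dom; rewrite (eq_measure_integral mu)//.
  by apply/mudom; exists (m%:C%C *: u).
have [w' Aw'] := Du'.
have Nu' : N u' ^+ 2 = N u ^+ 2.
  have := eqmu setT measurableT (@subset_refl _ _);
    rewrite muE// mu'E// !spectralT => -[].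
  by rewrite -!rnorm_sqE.
have w'u' : Re '[w', u'] = m * N u ^+ 2.
  rewrite (mu'int _ Aw')/= /Rintegral (eq_measure_integral mu)//.
  have := muint _ Au; rewrite ipZl ipvv -rmorphM => -[].
  by rewrite /Rintegral => ->.
(* The cross term of the polarization comes from the symmetry of [A], not from the scalar
   measures. *)
have w'u : Re '[w', u] = m * Re '[u', u].
  by rewrite (sa_sym saA Aw' Au) ipZr conjc_real ReZ.
pose h : R[i] := (2^-1)%:C%C.
have hh : h + h = 1 by rewrite /h -rmorphD; congr (_%:C%C); field.
pose w1 := h *: (m%:C%C *: u - w').
have u1h : u1 = h *: (u - u').
  by rewrite /u' subKr -[in RHS](scale1r u1) -scalerDl scalerA mulrDr mulr1 hh scale1r.
have Aw1 : A (u1, w1) by rewrite u1h; apply: sa_Z => //; exact: sa_B.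
have mean1 : Re '[w1, u1] = m * N u1 ^+ 2.
  clearbody u'; rewrite {2}u1h rnormZR exprMn real_normK ?num_real// rnorm_sqB Nu'.
  rewrite /w1 u1h ipZl ipZr conjc_real !ReZ ipBl !ipBr ipZl ipZl !ReD !ReN !ReZ.
  by rewrite !ReD !ReN w'u w'u' -rnorm_sqE (ipC u' u) ReJ; field.
have mu1T : fine (mu1 setT) = N u1 ^+ 2 by rewrite mu1E// spectralT -rnorm_sqE.
have E0 v : E set0 v = 0.
  have [mv [mvE _ _]] := sc v.
  have := mvE set0 measurable0; rewrite measure0 spectral_norm// => -[] /esym/eqP.
  by rewrite sqrf_eq0 => /eqP /rnorm_eq0.
have mu1S : mu1 S = 0%E.
  apply: (@mean_concentration _ _ m s) => //.
  - by rewrite mu1E// ltry.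
  - by apply/mu1dom; exists w1.
  - by rewrite mu1T -mean1 (mu1int _ Aw1).
  - rewrite mu1E; last exact: measurableC.
    by rewrite /u1 spectralI ?setICl ?E0 ?ip0l//; exact: measurableC.
apply: rnorm_eq0; apply/eqP; rewrite -sqrf_eq0.
have := mu1E S mS; rewrite mu1S /u1 spectral_idem// -rnorm_sqE => -[] <-.
by [].
Qed.

(** Both open half-lines at [m] are null for the scalar measure of [u], which is therefore a point
    mass at [m]. As eigenvectors are total, this determines [E] on measurable sets. *)
Lemma spectral_eigen (m : R) (S : set R) u : eigenvector A m u ->
  measurable S -> E S u = (\1_S m)%:C%C *: u.
Proof.
move=> Au mS.
pose Sp := `]m, +oo[%classic : set R; pose Sm := `]-oo, m[%classic : set R.
have mSp : measurable Sp by exact: measurable_itv.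
have mSm : measurable Sm by exact: measurable_itv.
have Ep : E Sp u = 0.
  apply: (@spectral_side m 1) => // t; rewrite /Sp/= in_itv/= andbT => h.
  by rewrite mul1r subr_gt0.
have Em : E Sm u = 0.
  apply: (@spectral_side m (-1)) => // t; rewrite /Sm/= in_itv/= => h.
  by rewrite mulN1r oppr_gt0 subr_lt0.
have [_ _ _ sc] := sE.
have [mu [muE _ _]] := sc u.
have muSp : mu Sp = 0%E by rewrite muE// Ep ip0l.
have muSm : mu Sm = 0%E by rewrite muE// Em ip0l.
have small S' : measurable S' -> ~ S' m -> mu S' = 0%E.
  move=> mS' S'm; apply/eqP; rewrite eq_le measure_ge0 andbT.
  have : (mu (Sp `|` Sm) <= 0)%E.
    have : (mu (Sp `|` Sm) <= mu Sp + mu Sm)%E by exact: measureU2.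
    by rewrite muSp muSm adde0.
  apply: le_trans; apply: le_measure; rewrite ?inE//; first exact: measurableU.
  move=> t S't; rewrite /Sp /Sm/= !in_itv/= andbT; case: (ltgtP m t) => [||mt];
    [by left|by right|].
  by move: S'm; rewrite mt.
rewrite indicE; have [/set_mem Sm'|/negP Sn] := boolP (m \in S).
  rewrite scale1r; have := small (~` S) (measurableC mS) (fun h => h Sm').
  move=> h; apply/eqP; rewrite -subr_eq0; apply/eqP/rnorm_eq0/eqP; rewrite -sqrf_eq0.
  rewrite rnorm_sqB -spectral_norm//.
  have : mu setT = (mu S + mu (~` S))%E.
    by rewrite -measureU ?setUv ?setICr//; exact: measurableC.
  rewrite h adde0 !muE// spectralT => -[]; rewrite -rnorm_sqE => ->.
  by apply/eqP; ring.
rewrite scale0r; apply: rnorm_eq0; apply/eqP; rewrite -sqrf_eq0 -spectral_norm//.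
have {}Sn : ~ S m by move=> /mem_set.
by have := small S mS Sn; rewrite muE// => -[] ->.
Qed.

End SpectralMeasureUnique.

(** * The bounded transform *)

Section BoundedTransform.
Variables (R : realType) (H : hilbertSpace R).
Implicit Types (u v w x y : H).

Local Notation i := ('i%C : R[i]).

(* [jbr t = (1 + t^2)^(-1/2)], so that [btr] is the scalar bounded transform. *)
Definition jbr (t : R) : R := (Num.sqrt (1 + t ^+ 2))^-1.
Definition btr (t : R) : R := t * jbr t.

Lemma jbr_gt0 t : 0 < jbr t.
Proof. by rewrite invr_gt0 sqrtr_gt0 ltr_pwDl ?sqr_ge0. Qed.

Lemma jbr_sq t : jbr t ^+ 2 = (1 + t ^+ 2)^-1.
Proof. by rewrite exprVn sqr_sqrtr// addr_ge0 ?sqr_ge0. Qed.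

Lemma btr_sq t : btr t ^+ 2 = 1 - jbr t ^+ 2.
Proof.
rewrite exprMn jbr_sq.
have h : 1 + t ^+ 2 != 0 by rewrite gt_eqF// ltr_pwDl ?sqr_ge0.
by field.
Qed.

Lemma jbr_le1 t : jbr t <= 1.
Proof.
rewrite -(@expr_le1 _ 2) ?(ltW (jbr_gt0 t))// jbr_sq invf_le1 ?ltr_pwDl ?sqr_ge0//.
by rewrite lerDl sqr_ge0.
Qed.

Lemma btr_le1 t : `|btr t| <= 1.
Proof.
rewrite -(@expr_le1 _ 2) ?normr_ge0// real_normK ?num_real// btr_sq.
by rewrite gerBl sqr_ge0.
Qed.

Lemma bdd_jbr : bddfun jbr.
Proof. by exists 1 => t; rewrite gtr0_norm ?jbr_gt0 ?jbr_le1. Qed.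

Lemma bdd_btr : bddfun btr.
Proof. by exists 1; exact: btr_le1. Qed.

(* Polarization. *)
Lemma nonneg_sym (B : H -> H) : linear B -> nonneg_operator B ->
  forall v w, '[B v, w] = '[v, B w].
Proof.
move=> lB B0 v w.
have BD a x y : B (a *: x + y) = a *: B x + B y by exact: lB.
have h1 := ger0_Im (B0 v); have h2 := ger0_Im (B0 w).
have h3 := ger0_Im (B0 (1 *: w + v)); have h4 := ger0_Im (B0 (i *: w + v)).
rewrite BD !ipDl !ipDr !ipZl !ipZr in h3; rewrite BD !ipDl !ipDr !ipZl !ipZr in h4.
rewrite (ipC v (B w)).
move: h1 h2 h3 h4; case: ('[B v, v]) => a1 b1; case: ('[B w, w]) => a2 b2.
case: ('[B v, w]) => a b; case: ('[B w, v]) => c d /= -> -> h3 h4.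
by congr (_ +i* _)%C; lra.
Qed.

Variables (A : set (H * H)) (saA : adjoint A = A).
Variables (L : set R) (e : nat -> H) (l : nat -> R) (eb : eigenbasis A L e l).

(** Whichever spectral measure is chosen, it acts on [e n] as the scalar [1_S(l n)], and by symmetry
    this fixes all coefficients. *)
Lemma spectral_projectionE (S : set R) : measurable S ->
  spectral_projection A S = fcalc e l \1_S.
Proof.
move=> mS; case: (eb) => [oe te el _].
have sE : is_spectral_measure A (xget (fun _ _ => 0) [set E | is_spectral_measure A E]).
  exact: (@xgetI _ _ _ _ (spectral_measure_ex saA eb)).
apply/funext => v; apply/esym/(fcalc_uniq eb); first exact: bdd_indic.
move=> n; rewrite (spectral_sym sE)// (spectral_eigen saA sE (el n))//.
by rewrite ipZr conjc_real.
Qed.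

Lemma sc_inv (a b : R) (z : R[i]) : a * (1 + b ^+ 2) = 1 ->
  a%:C%C * (b%:C%C * (b%:C%C * z) + z) = z.
Proof.
move=> h; have -> : b%:C%C * (b%:C%C * z) + z = (1 + b ^+ 2)%:C%C * z.
  by rewrite rmorphD rmorphXn rmorph1; ring.
by rewrite mulrA -rmorphM h mul1r.
Qed.

Lemma bounded_transform_ex : is_bounded_transform A (fcalc e l btr).
Proof.
case: (eb) => [oe te el _].
have bs : bddfun (fun t => Num.sqrt (jbr t)).
  by exists 1 => t; rewrite ger0_norm ?sqrtr_ge0// -sqrtr1 ler_wsqrtr// jbr_le1.
have bj := bdd_jbr; have bb := bdd_btr.
have bbj : bddfun (fun t => btr t * jbr t).
  by exists 1 => t; rewrite normrM mulr_ile1 ?normr_ge0 ?btr_le1// gtr0_norm ?jbr_gt0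
    ?jbr_le1.
have lp n : 1 + l n ^+ 2 != 0 by rewrite gt_eqF// ltr_pwDl ?sqr_ge0.
exists (fcalc e l jbr); split.
- by have [] := fcalc_selfadjoint eb bj.
(* Positivity: [jbr(A)] is the square of the self-adjoint operator [sqrt(jbr)(A)]. *)
- move=> v; rewrite (_ : jbr = fun t => Num.sqrt (jbr t) * Num.sqrt (jbr t));
  last first.
    by apply/funext => t; rewrite -expr2 sqr_sqrtr// ltW// jbr_gt0.
  by rewrite (fcalcM eb)// (fcalc_sym eb)// ipvv ler0c sqr_ge0.
- apply/seteqP; split => [[x y]|[x y]].
    move=> [[p q] /= [u]];
      rewrite saA => /(eigenbasis_graph saA eb) h1 /(eigenbasis_graph saA eb) h2 [pE
        xE].
    rewrite /graph/=; rewrite -(fcalcM eb)//; apply/esym; apply: (fcalc_uniq eb).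
      by exists 1 => t; rewrite normrM mulr_ile1 ?normr_ge0// gtr0_norm ?jbr_gt0
        ?jbr_le1.
    move=> n; rewrite -xE -pE ipDl h2 h1 -expr2 jbr_sq.
    by apply/esym/sc_inv; rewrite mulVf.
  rewrite /graph/= => ->.
  exists (fcalc e l jbr (fcalc e l jbr x), x - fcalc e l jbr (fcalc e l jbr x)) => /=;
    last by rewrite subrK.
  exists (fcalc e l (fun t => btr t * jbr t) x) => /=; rewrite ?saA;
    apply/(eigenbasis_graph saA eb) => n.
    by rewrite !(fcalcE eb)//= !mulrA -!rmorphM /btr; congr (_%:C%C * _); ring.
  rewrite ipBl !(fcalcE eb)//= !mulrA -!rmorphM -[X in X - _]mul1r -mulrBl -rmorphB.
  suff -> : l n * (btr (l n) * jbr (l n)) = 1 - jbr (l n) * jbr (l n) by [].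
  have := btr_sq (l n); rewrite /btr => h.
  by rewrite -[jbr _ * jbr _]expr2 -[RHS]h; ring.
- apply/seteqP; split => [[x y]|[x y]] /=.
    move=> [u]; rewrite /graph/= => -> /(eigenbasis_graph saA eb) h.
    apply/esym/(fcalc_uniq eb) => // n; rewrite h (fcalcE eb)// /btr.
    by rewrite mulrA -rmorphM.
  rewrite /graph/= => ->; exists (fcalc e l jbr x) => //=.
  apply/(eigenbasis_graph saA eb) => n; rewrite !(fcalcE eb)//.
  by rewrite mulrA -rmorphM.
Qed.

(** The nonnegative square root [B] in the specification is determined on each [e n], hence by
    symmetry everywhere, and the transform is [A B]. *)
Lemma bounded_transformE : bounded_transform A = fcalc e l btr.
Proof.
case: (eb) => [oe te el _].
have := @xgetI _ (fun=> 0) _ _ bounded_transform_ex; rewrite -/(bounded_transform A).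
move: (bounded_transform A) => T [B [[lB _] B0 BB AT]].
have symB := nonneg_sym lB B0.
have BZ a v : B (a *: v) = a *: B v.
  have := lB a v 0; rewrite addr0 => ->.
  have := lB (-1) v v; rewrite !scaleN1r !addNr => ->; by rewrite addr0.
have BN x y : B (x - y) = B x - B y.
  by rewrite [x - y]addrC -(scaleN1r y) lB scaleN1r addrC.
have Be n : B (e n) = (jbr (l n))%:C%C *: e n.
  set b := jbr (l n).
  have lp : 1 + l n ^+ 2 != 0 by rewrite gt_eqF// ltr_pwDl ?sqr_ge0.
  have h1 : B (B ((1 + l n ^+ 2)%:C%C *: e n)) = e n.
    have : graph (B \o B) ((1 + l n ^+ 2)%:C%C *: e n, e n).
      rewrite -BB; exists (e n, (l n)%:C%C *: ((l n)%:C%C *: e n)) => /=.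
        exists ((l n)%:C%C *: e n); first exact: el.
        by rewrite saA; apply: sa_Z => //; exact: el.
      congr (_, _); rewrite scalerA -rmorphM -[X in _ + X]scale1r -scalerDl -rmorphD.
      by rewrite -expr2 addrC.
    by rewrite /graph/= => <-.
  have h2 : B (B (e n)) = (b ^+ 2)%:C%C *: e n.
    rewrite /b jbr_sq -[in RHS]h1 !BZ scalerA -rmorphM mulVf// scale1r.
    by [].
  have b0 : 0 < b by exact: jbr_gt0.
  (* From [B^2 e = b^2 e] one gets [B w = - b w]; as [B] is nonnegative and [b > 0], [w]
     vanishes. *)
  pose w := B (e n) - b%:C%C *: e n.
  have hw : B w = (- b)%:C%C *: w.
    by rewrite /w BN BZ h2 rmorphN rmorphXn; vec.
  have := B0 w; rewrite hw ipZl ipvv -rmorphM ler0c mulNr oppr_ge0 pmulr_rle0// => h.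
  apply/eqP; rewrite -subr_eq0; apply/eqP/rnorm_eq0/eqP.
  by rewrite -sqrf_eq0 eq_le h sqr_ge0.
apply/funext => v; apply/esym/(fcalc_uniq eb); first exact: bdd_btr.
move=> n; have : graph T (v, T v) by [].
rewrite -AT => -[u hu /(eigenbasis_graph saA eb) ->] /=.
rewrite (_ : u = B v)//.
by rewrite symB Be ipZr conjc_real mulrA -rmorphM.
Qed.

End BoundedTransform.

(** * Norm continuity of the functional calculus *)

Section RealFunctions.
Variable R : realType.

Definition clamp (r t : R) : R := Num.max (- r) (Num.min t r).

Lemma btr_le (s t : R) : `|s| <= `|t| -> `|btr s| <= `|btr t|.
Proof.
move=> st; rewrite -ler_sqr ?nnegrE// !real_normK ?num_real// !btr_sq lerD2l lerN2.
rewrite !jbr_sq lef_pV2 ?posrE ?ltr_pwDl ?sqr_ge0// lerD2l.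
by rewrite -(real_normK (num_real s)) -(real_normK (num_real t)) ler_sqr ?nnegrE.
Qed.

Lemma btr_ge0 (t : R) : 0 <= t -> 0 <= btr t.
Proof. by move=> t0; rewrite mulr_ge0// ltW// jbr_gt0. Qed.

Lemma btrN (t : R) : btr (- t) = - btr t.
Proof. by rewrite /btr /jbr sqrrN mulNr. Qed.

Lemma clamp_id (r t : R) : `|t| <= r -> clamp r t = t.
Proof.
by rewrite ler_norml /clamp => /andP[h1 h2]; rewrite min_l// max_r.
Qed.

Lemma clamp_ge (r t : R) : 0 <= r -> r <= t -> clamp r t = r.
Proof.
by move=> r0 h; rewrite /clamp min_r// max_r//; lra.
Qed.

Lemma clamp_le (r t : R) : 0 <= r -> t <= - r -> clamp r t = - r.
Proof.
by move=> r0 h; rewrite /clamp min_l ?max_l//; lra.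
Qed.

Variant clamp_spec (r t : R) : R -> Prop :=
 | ClampId of `|t| <= r : clamp_spec r t t
 | ClampGe of r <= t : clamp_spec r t r
 | ClampLe of t <= - r : clamp_spec r t (- r).

Lemma clampP (r t : R) : 0 <= r -> clamp_spec r t (clamp r t).
Proof.
move=> r0; have [h|h] := leP `|t| r; first by rewrite clamp_id//; constructor.
have : r < t \/ t < - r.
  by move: h; rewrite ltr_normr => /orP[?|?]; [left|right; lra].
case=> {}h.
  by rewrite clamp_ge ?(ltW h)//; constructor; exact: ltW.
by rewrite clamp_le ?(ltW h)//; constructor; exact: ltW.
Qed.

Lemma clamp_norm (r t : R) : 0 <= r -> `|clamp r t| <= r.
Proof. by move=> r0; case: (clampP t r0) => // _; rewrite ?normrN ger0_norm. Qed.

(* As [btr] is odd and increasing, clamping commutes with it; the right-hand side is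
   the clamp of [btr t] to the interval with endpoints [btr r] and [- btr r]. *)
Lemma btr_clamp (r t : R) : 0 <= r ->
  btr (clamp r t) = (`|btr t + btr r| - `|btr t - btr r|) / 2.
Proof.
move=> r0; have rho := btr_ge0 r0; case: (clampP t r0) => h.
- have : `|btr t| <= btr r.
    by rewrite -[leRHS]ger0_norm//; apply: btr_le; rewrite (ger0_norm r0).
  rewrite ler_norml => /andP[h1 h2].
  by rewrite ger0_norm ?ler0_norm; lra.
- have : btr r <= btr t.
    rewrite -[leLHS]ger0_norm// -[leRHS]ger0_norm ?btr_ge0 ?(le_trans r0)//.
    by apply: btr_le; rewrite !ger0_norm// (le_trans r0).
  by move=> h1; rewrite !ger0_norm; lra.
- have : btr r <= - btr t.
    have t0 : 0 <= - t by lra.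
    rewrite -btrN -[leLHS]ger0_norm// -[leRHS]ger0_norm ?btr_ge0//.
    by apply: btr_le; rewrite !ger0_norm//; lra.
  by move=> h1; rewrite btrN !ler0_norm; lra.
Qed.

(** The formula [s (1 - s^2)^(-1/2)] inverts the bounded transform. *)
Lemma clampE (r t : R) : clamp r t = btr (clamp r t) * (Num.sqrt (1 - btr (clamp r t)
  ^+ 2))^-1.
Proof.
by rewrite btr_sq opprB addrCA subrr addr0 sqrtr_sqr gtr0_norm ?jbr_gt0// /btr mulfK//
  gt_eqF// jbr_gt0.
Qed.

(** Uniformity in [t] allows the level [r y] to be replaced by [r x] in the proof of continuity at
    [x]. *)
Lemma clamp_dist (r s t : R) : 0 <= r -> 0 <= s -> `|clamp r t - clamp s t| <= `|r - s|.
Proof.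
move=> r0 s0; have := ler_norm (r - s); have := ler_norm (s - r);
  rewrite (distrC s) => h1 h2.
case: (clampP t r0) => a; case: (clampP t s0) => b;
  rewrite ler_norml; move: a b; rewrite ?ler_norml => a b; apply/andP; split;
  move: a b; try (move=> /andP[? ?]); try (move=> ? /andP[? ?]); try (move=> ? ?); lra.
Qed.

(** The iteration [q + (t - q^2) / 2] increases to [sqrt t] on [[0, 1]]; its terms are polynomials
    in [t], so algebraic operations suffice to form them. *)
Fixpoint sqrt_approx (t : R) (n : nat) : R :=
  if n is m.+1 then sqrt_approx t m + (t - sqrt_approx t m ^+ 2) * 2^-1 else 0.

(** With [s = sqrt t], one step multiplies the error [s - q] by [1 - (s + q) / 2], which lies
    between [0] and [1 - s / 2]. *)
Lemma sqrt_approxP (t : R) n : 0 <= t <= 1 ->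
  0 <= sqrt_approx t n <= Num.sqrt t /\
  Num.sqrt t - sqrt_approx t n <= Num.sqrt t * (1 - Num.sqrt t / 2) ^+ n.
Proof.
move=> /andP[t0 t1]; have ts := sqr_sqrtr t0.
have s0 := sqrtr_ge0 t; have s1 : Num.sqrt t <= 1 by rewrite -sqrtr1 ler_wsqrtr.
elim: n => [|n [/andP[h1 h2] h3]] /=.
  by rewrite lexx s0 subr0 expr0 mulr1.
rewrite -[X in X - _ ^+ 2]ts; move: (Num.sqrt t) s0 s1 h1 h2 h3 => s s0 s1.
move: (sqrt_approx t n) => q h1 h2 h3.
have e : s - (q + (s ^+ 2 - q ^+ 2) * 2^-1) = (s - q) * (1 - (s + q) / 2) by field.
split.
  apply/andP; split; first by rewrite addr_ge0// mulr_ge0// subr_ge0 ler_sqr.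
  by rewrite -subr_ge0 e mulr_ge0//; lra.
rewrite e exprSr mulrA; apply: ler_pM; rewrite ?subr_ge0//; lra.
Qed.

(* With [y = sqrt t / 2], Bernoulli's inequality bounds [(1 - y)^n] by [1 / (1 + n y)].
  *)
Lemma sqrt_approx_unif (t : R) n : 0 <= t <= 1 ->
  `|Num.sqrt t - sqrt_approx t n.+1| <= 2 / n.+1%:R.
Proof.
move=> t01; have [/andP[h1 h2] h3] := sqrt_approxP n.+1 t01.
rewrite ger0_norm ?subr_ge0//; apply: le_trans h3 _.
have /andP[t0 t1] := t01.
have s0 := sqrtr_ge0 t; have s1 : Num.sqrt t <= 1 by rewrite -sqrtr1 ler_wsqrtr.
move: (Num.sqrt t) s0 s1 => s s0 s1.
set y := s / 2; have y0 : 0 <= y by rewrite divr_ge0.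
have y1 : 0 <= 1 - y by rewrite /y; lra.
have bern m : (1 - y) ^+ m * (1 + m%:R * y) <= 1.
  elim: m => [|m ih]; first by rewrite expr0 mul0r addr0 mulr1.
  apply: le_trans ih; rewrite exprSr -mulrA ler_wpM2l ?exprn_ge0//.
  by rewrite -natr1; have : 0 <= m%:R :> R by []; move: (m%:R : R) => k k0; nra.
have n0 : 0 < n.+1%:R :> R by [].
rewrite ler_pdivlMr//.
have -> : s = 2 * y by rewrite /y mulrCA divff ?mulr1.
have := bern n.+1; have : 0 <= (1 - y) ^+ n.+1 by rewrite exprn_ge0.
move: (_ ^+ n.+1) (n.+1%:R : R) n0 => z k k0; nra.
Qed.

End RealFunctions.

(** * The functions with norm continuous calculus *)

Section ContinuousCalculus.
Variables (R : realType) (H : hilbertSpace R).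
Implicit Types (v w : H).

Variables (X : topologicalType) (A : X -> set (H * H)).
Variables (e : X -> nat -> H) (l : X -> nat -> R) (L : set R).
Hypothesis eb : forall x, eigenbasis (A x) L (e x) (l x).
Variable x0 : X.

Local Notation F := (fun p x => fcalc (e x) (l x) p).

(* [x |-> p(A_x)] is norm continuous at [x0]. *)
Definition fcont (p : R -> R) := bddfun p /\
  forall d : R, 0 < d ->
    \forall x \near x0, bounded_by (fun v => F p x v - F p x0 v) d.

Lemma bddfun_ge0 (p : R -> R) : bddfun p -> exists2 M, 0 < M & forall t, `|p t| <= M.
Proof.
move=> [M pM]; exists (1 + `|M|); first by rewrite ltr_pwDl.
by move=> t; apply: le_trans (pM t) _; apply: le_trans (ler_norm _) _; rewrite lerDr.
Qed.

Lemma bddfun_cst c : bddfun (fun=> c : R).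
Proof. by exists `|c|. Qed.

Lemma bddfunD (p q : R -> R) : bddfun p -> bddfun q -> bddfun (fun t => p t + q t).
Proof.
move=> [M pM] [M' qM]; exists (M + M') => t.
by apply: le_trans (ler_normD _ _) _; rewrite lerD.
Qed.

Lemma bddfunM (p q : R -> R) : bddfun p -> bddfun q -> bddfun (fun t => p t * q t).
Proof. by move=> [M pM] [M' qM]; exists (M * M') => t; rewrite normrM ler_pM. Qed.

Lemma fcalcD x (p q : R -> R) v : bddfun p -> bddfun q ->
  F (fun t => p t + q t) x v = F p x v + F q x v.
Proof.
move=> bp bq; apply: (fcalc_uniq (eb x)); first exact: bddfunD.
by move=> n; rewrite ipDl !(fcalcE (eb x))// rmorphD mulrDl.
Qed.

Lemma fcalc_cst x (c : R) v : F (fun=> c) x v = c%:C%C *: v.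
Proof.
apply: (fcalc_uniq (eb x)); first exact: bddfun_cst.
by move=> n; rewrite ipZl.
Qed.

Lemma fcont_cst c : fcont (fun=> c).
Proof.
split; first exact: bddfun_cst.
move=> d d0; apply: nearW => x v; rewrite !fcalc_cst subrr rnorm0.
by rewrite mulr_ge0 ?rnorm_ge0// ltW.
Qed.

Lemma fcontD p q : fcont p -> fcont q -> fcont (fun t => p t + q t).
Proof.
move=> [bp cp] [bq cq]; split; first exact: bddfunD.
move=> d d0; have d2 : 0 < d / 2 by rewrite divr_gt0.
apply: filterS2 (cp _ d2) (cq _ d2) => x hp hq v.
rewrite !fcalcD// opprD addrACA; apply: le_trans (rnormD _ _) _.
by apply: le_trans (lerD (hp v) (hq v)) _; rewrite -mulrDl -splitr.
Qed.

Lemma fcontM p q : fcont p -> fcont q -> fcont (fun t => p t * q t).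
Proof.
move=> [bp cp] [bq cq]; split; first exact: bddfunM.
have [M M0 pM] := bddfun_ge0 bp; have [M' M'0 qM] := bddfun_ge0 bq.
move=> d d0; have d2 : 0 < d / 2 / M by rewrite !divr_gt0.
have d2' : 0 < d / 2 / M' by rewrite !divr_gt0.
apply: filterS2 (cp _ d2') (cq _ d2) => x hp hq v.
rewrite !(fcalcM (eb _))//.
have -> : F p x (F q x v) - F p x0 (F q x0 v) =
    F p x (F q x v - F q x0 v) + (F p x (F q x0 v) - F p x0 (F q x0 v)).
  by rewrite (fcalcB (eb _))// subrKA.
apply: le_trans (rnormD _ _) _.
rewrite (splitr d) mulrDl; apply: lerD.
  apply: le_trans ((fcalc_bounded (eb x) pM) _) _.
  by rewrite -ler_pdivlMl// mulrA (mulrC M^-1).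
apply: le_trans (hp _) _; rewrite -mulrA ler_wpM2l ?divr_ge0 ?(ltW d0)//.
by rewrite ler_pdivrMl//; exact: (fcalc_bounded (eb x0) qM).
Qed.

Lemma fcont_ext p q : p =1 q -> fcont p -> fcont q.
Proof. by move=> /funext ->. Qed.

Lemma fcont_lim p : bddfun p ->
  (forall d : R, 0 < d -> exists2 q, fcont q & forall t, `|p t - q t| <= d) -> fcont p.
Proof.
move=> bp h; split => // d d0; have d3 : 0 < d / 3 by rewrite divr_gt0.
have [q [bq cq] pq] := h _ d3.
have close x v : N (F p x v - F q x v) <= d / 3 * N v.
  have -> : F p x v - F q x v = F (fun t => p t - q t) x v.
    apply/esym/(fcalc_uniq (eb x)); first by exists (d / 3).
    by move=> n; rewrite ipBl !(fcalcE (eb x))// rmorphB mulrBl.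
  exact: (fcalc_bounded (eb x) pq).
apply: filterS (cq _ d3) => x hq v.
have -> : F p x v - F p x0 v =
    (F p x v - F q x v) + (F q x v - F q x0 v) + (F q x0 v - F p x0 v).
  by rewrite subrKA subrKA.
apply: le_trans (rnormD _ _) _; apply: le_trans (lerD (rnormD _ _) (lexx _)) _.
rewrite (rnormBC (F q x0 v)); have := close x v; have := close x0 v; have := hq v => /=.
by move: (N _) (N _) (N _) (N _) => a b c s; lra.
Qed.

Lemma fcont_sqrt01 p : (forall t, 0 <= p t <= 1) -> fcont p ->
  fcont (fun t => Num.sqrt (p t)).
Proof.
move=> p01 cp; apply: fcont_lim.
  exists 1 => t; rewrite ger0_norm ?sqrtr_ge0// -sqrtr1 ler_wsqrtr//.
  by case/andP: (p01 t).
move=> d d0; have [|n0 hn] := @invr_small _ (d / 2); first by rewrite divr_gt0.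
exists (fun t => sqrt_approx (p t) n0.+1).
  elim: (n0.+1) => [|n ih]; first exact: fcont_cst.
  apply: fcontD => //; apply: fcontM; last exact: fcont_cst.
  apply: fcontD => //; apply: (@fcont_ext (fun t => -1 * (sqrt_approx (p t) n *
    sqrt_approx (p t) n))).
    by move=> t; rewrite mulN1r.
  by apply: fcontM; [exact: fcont_cst | exact: fcontM].
move=> t; apply: le_trans (sqrt_approx_unif _ (p01 t)) _.
by rewrite mulrC -ler_pdivlMr// ltW// hn.
Qed.

Lemma fcont_sqrt p : (forall t, 0 <= p t) -> fcont p -> fcont (fun t => Num.sqrt (p t)).
Proof.
move=> p0 cp; have [M M0 pM] := bddfun_ge0 cp.1.
apply: (@fcont_ext (fun t => Num.sqrt M * Num.sqrt (p t * M^-1))).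
  by move=> t; rewrite -sqrtrM ?(ltW M0)// mulrCA divff ?mulr1// gt_eqF.
apply: fcontM; first exact: fcont_cst.
apply: fcont_sqrt01; last by apply: fcontM => //; exact: fcont_cst.
move=> t; rewrite mulr_ge0 ?invr_ge0 ?(ltW M0)//= ler_pdivrMr// mul1r.
exact: le_trans (ler_norm _) (pM t).
Qed.

Lemma fcont_abs p : fcont p -> fcont (fun t => `|p t|).
Proof.
move=> cp; apply: (@fcont_ext (fun t => Num.sqrt (p t * p t))).
  by move=> t; rewrite -expr2 sqrtr_sqr.
by apply: fcont_sqrt; [move=> t; rewrite -expr2 sqr_ge0 | exact: fcontM].
Qed.

(** For [q = 1 / p], [q(A_x) - q(A_x0) = q(A_x) (p(A_x0) - p(A_x)) q(A_x0)]. Each outer factor has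
    norm at most [c^-1], hence the tolerance [d * c * c]. *)
Lemma fcont_inv p (c : R) : 0 < c -> (forall t, c <= p t) -> fcont p ->
  fcont (fun t => (p t)^-1).
Proof.
move=> c0 cp [bp hp].
have p0 t : 0 < p t by exact: lt_le_trans (cp t).
have pc t : `|(p t)^-1| <= c^-1.
  by rewrite gtr0_norm ?invr_gt0// lef_pV2 ?posrE.
have bi : bddfun (fun t => (p t)^-1) by exists c^-1.
split => // d d0; have d2 : 0 < d * c * c by rewrite !mulr_gt0.
apply: filterS (hp _ d2) => x h v.
set q := fun t => (p t)^-1.
have pq y w : F p y (F q y w) = w.
  rewrite -(fcalcM (eb y))//; apply: (fcalc_uniq (eb y)); first exact: bddfunM.
  by move=> n; rewrite /q divff ?mul1r// gt_eqF.
have qp y w : F q y (F p y w) = w.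
  rewrite -(fcalcM (eb y))//; apply: (fcalc_uniq (eb y)); first exact: bddfunM.
  by move=> n; rewrite /q mulVf ?mul1r// gt_eqF.
have -> : F q x v - F q x0 v = F q x (F p x0 (F q x0 v) - F p x (F q x0 v)).
  by rewrite (fcalcB (eb x))// pq qp.
apply: le_trans (fcalc_bounded (eb x) pc _) _; rewrite rnormBC.
apply: le_trans (ler_wpM2l _ (h _)) _; first by rewrite invr_ge0 ltW.
apply: le_trans (_ : c^-1 * (d * c * c * (c^-1 * N v)) <= _).
  rewrite ler_wpM2l ?invr_ge0 ?(ltW c0)// ler_wpM2l ?(ltW d2)//.
  exact: (fcalc_bounded (eb x0) pc).
by rewrite le_eqVlt; apply/orP; left; apply/eqP; field; rewrite gt_eqF.
Qed.

(** Absolute values produce [btr] of the clamp, and the bounded transform is then inverted. Since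
    the clamp is bounded by [r], the square root in the denominator is at least [jbr r > 0]. *)
Lemma fcont_clamp r : 0 < r -> fcont (@btr R) -> fcont (clamp r).
Proof.
move=> r0 cb; have r0' := ltW r0.
have cN p : fcont p -> fcont (fun t => - p t).
  move=> cp; apply: (@fcont_ext (fun t => -1 * p t)); first by move=> t; rewrite mulN1r.
  by apply: fcontM => //; exact: fcont_cst.
have cbc : fcont (fun t => btr (clamp r t)).
  apply: (@fcont_ext (fun t => (`|btr t + btr r| + - `|btr t + - btr r|) * 2^-1)).
    by move=> t; rewrite btr_clamp.
  apply: fcontM; last exact: fcont_cst.
  apply: fcontD; last apply: cN; apply: fcont_abs; apply: fcontD => //;
    exact: fcont_cst.
apply: (@fcont_ext (fun t => btr (clamp r t) * (Num.sqrt (1 + - (btr (clamp r t) * btr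
  (clamp r t))))^-1)).
  by move=> t; rewrite [RHS]clampE.
apply: fcontM => //; apply: (@fcont_inv _ (jbr r)); first exact: jbr_gt0.
  move=> t; rewrite -expr2 btr_sq opprB addrCA subrr addr0 sqrtr_sqr gtr0_norm
    ?jbr_gt0//.
  rewrite -ler_sqr ?nnegrE ?(ltW (jbr_gt0 _))// !jbr_sq lef_pV2 ?posrE ?ltr_pwDl
    ?sqr_ge0// lerD2l.
  by rewrite -(real_normK (num_real (clamp r t))) ler_sqr ?nnegrE// clamp_norm.
apply: fcont_sqrt.
  by move=> t; rewrite -expr2 btr_sq opprB addrCA subrr addr0 sqr_ge0.
by apply: fcontD; [exact: fcont_cst | apply: cN; exact: fcontM].
Qed.

End ContinuousCalculus.

(** * Trivializing operators *)

Section Trivializing.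
Variables (R : realType) (H : hilbertSpace R).
Implicit Types (u v w x y : H).

Lemma RKsa_eigenbasis (A : set (H * H)) : separable H -> RKsa A ->
  exists e l, eigenbasis A setT e l.
Proof.
move=> sepH [[[_ _ sv] _ _] saA [K cK KA]].
by apply: eigenbasis_ex => //; exact: total_eigenvectors cK KA sv.
Qed.

Definition reflection (P : H -> H) v := P v + P v - v.

Definition trivializer (e : nat -> H) (l : nat -> R) (r : R) (P : H -> H) v : H :=
  r%:C%C *: reflection P v - fcalc e l (clamp r) v.

Section Projection.
Variables (P : H -> H) (pP : orthogonal_projection P).

Lemma proj_linear : linear P. Proof. by case: pP => [[[]]]. Qed.
Lemma proj_sym v w : '[P v, w] = '[v, P w]. Proof. by case: pP => [[_]]. Qed.
Lemma proj_idem v : P (P v) = P v. Proof. by case: pP. Qed.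
Lemma projB v w : P (v - w) = P v - P w.
Proof. by rewrite [v - w]addrC -(scaleN1r w) proj_linear scaleN1r addrC. Qed.
Lemma proj0 : P 0 = 0. Proof. by rewrite -[X in P X](subrr 0) projB subrr. Qed.
Lemma projZ a v : P (a *: v) = a *: P v.
Proof. by rewrite -[_ *: v]addr0 proj_linear proj0 addr0. Qed.
Lemma proj_norm v : Re '[P v, v] = N (P v) ^+ 2.
Proof. by rewrite rnorm_sqE -proj_sym proj_idem. Qed.

Lemma reflection_norm v : N (reflection P v) = N v.
Proof.
apply/eqP; rewrite -(@eqrXn2 _ 2) ?rnorm_ge0// rnorm_sqB rnorm_sqD ipDl ReD.
by rewrite proj_norm -!rnorm_sqE; apply/eqP; ring.
Qed.

Lemma reflection_sym v w : '[reflection P v, w] = '[v, reflection P w].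
Proof. by rewrite /reflection !ipBl !ipBr !ipDl !ipDr !proj_sym. Qed.

End Projection.

Variables (A : set (H * H)) (saA : adjoint A = A).
Variables (e : nat -> H) (l : nat -> R) (eb : eigenbasis A setT e l).
Variables (r : R) (r0 : 0 < r) (n0 : nat).
Hypothesis disc : forall n, (n0 <= n)%N -> e n != 0 -> r <= `|l n|.
Variables (P : H -> H) (sP : spectral_section_at r A P).

Let pP : orthogonal_projection P. Proof. by case: sP. Qed.
Let C := trivializer e l r P.
(** The range of [1_(-r,r)(A)] in coordinates. *)
Let V := [set v | forall n, r <= `|l n| -> '[v, e n] = 0].

Lemma bdd_clamp : bddfun (clamp r).
Proof. by exists r => t; apply: clamp_norm; exact: ltW. Qed.

(** The lower bound on [P] gives [<P v, v> >= |v|^2], while [|v - P v|^2 = |v|^2 - <P v, v>]. *)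
Lemma section_top m v : r <= m -> eigenvector A m v -> P v = v.
Proof.
move=> rm Av; case: sP => _ + _; rewrite (spectral_projectionE saA eb);
  last exact: measurable_itv.
move/(_ v); rewrite (fcalc_eigen saA eb (bdd_indic _) Av) indicE mem_set ?scale1r;
  last first.
  by rewrite /= in_itv/= rm.
rewrite ipBl => h; have {}h : Re '[v, v] <= Re '[P v, v].
  by move: h; rewrite subr_ge0 lecE => /andP[].
apply/esym/eqP; rewrite -subr_eq0; apply/eqP/rnorm_eq0/eqP;
  rewrite -sqrf_eq0 eq_le sqr_ge0 andbT.
rewrite rnorm_sqB -(proj_norm pP) (ipC v) ReJ rnorm_sqE; lra.
Qed.

Lemma section_bot m v : m <= - r -> eigenvector A m v -> P v = 0.
Proof.
move=> rm Av; case: sP => _ _; rewrite (spectral_projectionE saA eb);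
  last exact: measurable_itv.
move/(_ v); rewrite (fcalc_eigen saA eb (bdd_indic _) Av) indicE memNset ?scale0r;
  last first.
  by rewrite /= in_itv/= andbT; apply/negP; rewrite -leNgt.
rewrite sub0r ipNl => h; have {}h : Re '[P v, v] <= 0.
  by move: h; rewrite oppr_ge0 lecE => /andP[].
apply/rnorm_eq0/eqP; rewrite -sqrf_eq0 eq_le sqr_ge0 andbT.
by rewrite -(proj_norm pP).
Qed.

Lemma abs_cases (m : R) : r <= `|m| -> r <= m \/ m <= - r.
Proof. by rewrite ler_normr => /orP[?|?]; [left|right; lra]. Qed.

Lemma trivializer_sym v w : '[C v, w] = '[v, C w].
Proof.
rewrite /C /trivializer ipBl ipBr ipZl ipZr conjc_real (fcalc_sym eb) ?reflection_sym//.
exact: bdd_clamp.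
Qed.

Lemma trivializer_linear : linear C.
Proof.
move=> a v w; rewrite /C /trivializer /reflection (fcalc_linear eb bdd_clamp).
by rewrite proj_linear//; vec.
Qed.

(** Here [r (2 P - 1)] and the clamp act by the same scalar, [r] or [- r]. *)
Lemma trivializer_eigen0 m v : r <= `|m| -> eigenvector A m v -> C v = 0.
Proof.
move=> rm Av; rewrite /C /trivializer /reflection (fcalc_eigen saA eb bdd_clamp Av).
have [h|h] := abs_cases rm.
  by rewrite (section_top h Av) addrK clamp_ge ?subrr// ltW.
by rewrite (section_bot h Av) clamp_le ?(ltW r0)//; vec.
Qed.

Lemma trivializer_V v : V (C v).
Proof.
move=> n rn; have [_ _ el _] := eb.
by rewrite trivializer_sym (trivializer_eigen0 rn (el n)) ip0r.
Qed.

(** [P] acts as [1] or [0] on the basis vectors outside [(-r, r)], so by symmetry it preserves their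
    orthogonal complement. *)
Lemma proj_V v : V v -> V (P v).
Proof.
move=> Vv n rn; have [_ _ el _] := eb; rewrite proj_sym//.
have [h|h] := abs_cases rn.
  by rewrite (section_top h (el n)) Vv.
by rewrite (section_bot h (el n)) ip0r.
Qed.

Lemma V_coefE v : V v <-> fcalc e l \1_`](- r), r[ v = v.
Proof.
have bi := @bdd_indic R `](- r), r[; split=> [Vv|<- n rn].
  apply: (fcalc_uniq eb) => // n; rewrite indicE.
  have [h|] := boolP (l n \in _); first by rewrite mul1r.
  move/negP => h; rewrite Vv ?mulr0// leNgt; apply/negP => h'; apply: h.
  by apply/mem_set; rewrite /= in_itv/= -ltr_norml.
rewrite (fcalcE eb)// indicE memNset ?mul0r//= in_itv/= -ltr_norml.
by apply/negP; rewrite -leNgt.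
Qed.

Lemma trivializer_range : range C `<=` range (spectral_projection A `](- r), r[).
Proof.
move=> _ [v _ <-]; exists (C v) => //.
rewrite (spectral_projectionE saA eb); last exact: measurable_itv.
exact: (V_coefE _).1 (trivializer_V v).
Qed.

Lemma trivializer_finite_rank : finite_rank C.
Proof.
exists n0, (fun k : 'I_n0 => e k) => _ [v _ <-].
exists (fun k : 'I_n0 => '[C v, e k]) => //.
have [oe te _ _] := eb.
rewrite -(big_mkord xpredT (fun k => '[C v, e k] *: e k)).
apply: (total_eq te) => n; rewrite cf_sum//; last exact: compat_cf.
case: ifPn => //=; rewrite -leqNgt => nn.
have [->|en] := eqVneq (e n) 0; first by rewrite ip0r.
by rewrite trivializer_V// disc.
Qed.

(** Strictness comes from discreteness: only indices below [n0] can carry a nonzero basis vector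
    with eigenvalue in [(-r, r)], so the moduli of these eigenvalues are bounded by some [r' < r],
    and [s = r + r']. *)
Lemma trivializer_bound : exists2 s, 0 <= s < 2 * r & bounded_by C s.
Proof.
have [r' [r'0 r'r hr']] : exists r', [/\ 0 <= r', r' < r & forall n, `|l n| < r -> e n
  != 0 -> `|l n| <= r'].
  suff [r' [r'0 r'r hr']] : exists r', [/\ 0 <= r', r' < r &
      forall n, (n < n0)%N -> `|l n| < r -> `|l n| <= r'].
    exists r'; split => // n ln en; apply: hr' => //; rewrite ltnNge.
    by apply/negP => /disc /(_ en); rewrite leNgt ln.
  elim: n0 => [|k [s [s0 sr hs]]]; first by exists 0; split.
  have [h|h] := ltP `|l k| r; last first.
    exists s; split => // n; rewrite ltnS leq_eqVlt => /orP[/eqP ->|]; last exact: hs.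
    by rewrite ltNge h.
  exists (Num.max s `|l k|); split; rewrite ?le_max ?s0// ?gt_max ?sr//.
  move=> n; rewrite ltnS leq_eqVlt => /orP[/eqP ->|nk ln];
    first by rewrite le_max lexx orbT.
  by rewrite le_max hs.
exists (r + r'); first by apply/andP; split; [rewrite addr_ge0// ltW | lra].
move=> v; have bi := @bdd_indic R `](- r), r[.
(* [C v] lies in [V], so composing with [1_(-r,r)(A)] changes nothing; it cuts the clamp down to the
   eigenvalues bounded by [r']. *)
have <- : fcalc e l \1_`](- r), r[ (C v) = C v by apply/V_coefE/trivializer_V.
rewrite /C /trivializer (fcalcB eb)// (fcalcZ eb)//.
apply: le_trans (rnormB _ _) _; rewrite mulrDl; apply: lerD.
  rewrite rnormZR ger0_norm ?(ltW r0)// ler_wpM2l ?(ltW r0)//.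
  rewrite -[leRHS]mul1r -(reflection_norm pP v); apply: (fcalc_bounded eb) => t.
  by rewrite indicE; case: (_ \in _); rewrite ?normr1// normr0.
have bc := bdd_clamp.
rewrite -(fcalcM eb)//; apply: (fcalc_bounded_on eb) => //; first exact: bddfunM.
move=> n en; rewrite indicE; have [h|h] := boolP (l n \in _);
  last by rewrite mul0r normr0.
move/set_mem : h; rewrite /= in_itv/= -ltr_norml => h.
by rewrite mul1r clamp_id ?(ltW h)// hr'.
Qed.

Lemma trivializer_selfadjoint : bounded_selfadjoint C.
Proof.
have [s _ hs] := trivializer_bound; split; last exact: trivializer_sym.
exact: bounded_operator_intro trivializer_linear hs.
Qed.

Let B := op_add A C.

Lemma op_add_graph v w : B (v, w) <-> A (v, w - C v).
Proof.
split=> [[[p q] /= Apq [<- <-]]|h]; first by rewrite addrK.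
by exists (v, w - C v) => //=; rewrite subrK.
Qed.

Lemma op_add_selfadjoint : adjoint B = B.
Proof.
apply/seteqP; split => [[v w] h|[v w] /op_add_graph h [p q] /op_add_graph pq] /=.
  apply/op_add_graph; apply: sa_intro => // p q pq.
  have := h (p, q + C p); rewrite /= => /(_ _); rewrite ipDl ipBr trivializer_sym => <-.
    by rewrite addrK.
  by apply/op_add_graph; rewrite addrK.
have := sa_sym saA pq h; rewrite ipBl ipBr trivializer_sym.
by move/addIr.
Qed.

(** Eigenvectors of [A + C] away from the gap [(-r, r)] on which [P] already acts as
    [1_[0,+oo)(A + C)]. Totality of this set gives both invertibility and agreement with [P]. *)
Let S : set H := [set u | exists m, [/\ r <= `|m|, eigenvector B m u &
  P u = (\1_`[0, +oo[ m)%:C%C *: u]].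

(** On [V] the clamp is inactive; in particular [V] lies in the domain of [A]. *)
Lemma clamp_V v : V v -> A (v, fcalc e l (clamp r) v).
Proof.
move=> Vv; apply/(eigenbasis_graph saA eb) => n; rewrite (fcalcE eb _ _ bdd_clamp).
have [h|h] := leP r `|l n|; first by rewrite Vv// !mulr0.
by rewrite clamp_id// ltW.
Qed.

(** Basis vectors outside [(-r, r)] belong to [S], so a [v] orthogonal to [S] lies in [V]. Then
    [P v] and [v - P v] belong to [S] with eigenvalues [r] and [- r], and [v] is orthogonal to
    both. *)
Lemma section_total : total S.
Proof.
move=> v hv; have [_ _ el _] := eb.
have Vv : V v.
  move=> n rn; apply: hv; exists (l n); split => //.
    apply/op_add_graph; rewrite (trivializer_eigen0 rn (el n)) subr0; exact: el.
  have [h|h] := abs_cases rn.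
    by rewrite (section_top h (el n)) indicE mem_set ?scale1r//= in_itv/= andbT
      (le_trans (ltW r0)).
  rewrite (section_bot h (el n)) indicE memNset ?scale0r//= in_itv/= andbT.
  by apply/negP; rewrite -ltNge (le_lt_trans h)// oppr_lt0.
have VP := proj_V Vv.
have h1 : '[v, P v] = 0.
  apply: hv; exists r; split; first by rewrite ler_norm.
    apply/op_add_graph; have := clamp_V VP; congr (A (_, _)).
    by rewrite /C /trivializer /reflection proj_idem// addrK opprB addrC subrK.
  by rewrite proj_idem// indicE mem_set ?scale1r//= in_itv/= andbT ltW.
have h2 : '[v, v - P v] = 0.
  have P0 : P (v - P v) = 0 by rewrite projB// proj_idem// subrr.
  apply: hv; exists (- r); split; first by rewrite normrN ler_norm.
    have VvP : V (v - P v) by move=> n rn; rewrite ipBl Vv// VP// subrr.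
    apply/op_add_graph; have := clamp_V VvP; congr (A (_, _)).
    by rewrite /C /trivializer /reflection P0 rmorphN; vec.
  rewrite P0 indicE memNset ?scale0r//= in_itv/= andbT.
  by apply/negP; rewrite -ltNge oppr_lt0.
by apply: ip_eq0; rewrite -{2}(subrK (P v) v) ipDr h1 h2 addr0.
Qed.

Hypothesis sepH : separable H.

Lemma perturbed_eigenbasis : exists e' l', eigenbasis B [set m | r <= `|m|] e' l'.
Proof.
apply: eigenbasis_ex => //; first exact: op_add_selfadjoint.
move=> v hv; apply: section_total => u [m [rm Bu _]]; apply: hv.
by exists m.
Qed.

Lemma section_agrees : P = spectral_projection B `[0, +oo[.
Proof.
have [e' [l' eb']] := perturbed_eigenbasis.
have saB := op_add_selfadjoint.
rewrite (spectral_projectionE saB eb'); last exact: measurable_itv.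
apply/funext => v; apply/eqP; rewrite -subr_eq0;
  apply/eqP/section_total => u [m [_ Bu Pu]].
have bi := @bdd_indic R `[0, +oo[.
by rewrite ipBl proj_sym// (fcalc_sym eb')// (fcalc_eigen saB eb' bi Bu) -Pu subrr.
Qed.

Lemma perturbed_invertible : invertible B.
Proof.
have [e' [l' eb']] := perturbed_eigenbasis.
have saB := op_add_selfadjoint.
have [oe te _ lr] := eb'.
(* The value [0] inside the gap keeps [p] bounded on the whole line; at eigenvalues of nonzero basis
   vectors it is the inverse. *)
pose p (t : R) := if r <= `|t| then t^-1 else 0.
have pb t : `|p t| <= r^-1.
  rewrite /p; case: ifPn => h; last by rewrite normr0 invr_ge0 ltW.
  by rewrite normfV lef_pV2 ?posrE// (lt_le_trans r0).
have bp : bddfun p by exists r^-1.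
have pl n : e' n != 0 -> p (l' n) * l' n = 1.
  move=> /lr /= h; rewrite /p h mulVf// -normr_gt0; exact: lt_le_trans h.
exists (fcalc e' l' p); first by have [] := fcalc_selfadjoint eb' bp.
apply/seteqP; split => [[x y] /(eigenbasis_graph saB eb') h|[x y]]; rewrite /graph/=.
  apply/esym/(fcalc_uniq eb') => // n; rewrite h mulrA -rmorphM.
  have [->|/pl ->] := eqVneq (e' n) 0; first by rewrite !ip0r !mulr0.
  by rewrite mul1r.
move=> ->; apply/(eigenbasis_graph saB eb') => n /=;
  rewrite (fcalcE eb')// mulrA -rmorphM.
have [->|/pl] := eqVneq (e' n) 0; first by rewrite !ip0r !mulr0.
by rewrite mulrC => ->; rewrite mul1r.
Qed.

End Trivializing.

(** * Continuity of the family of trivializing operators *)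

Lemma fcont_btr (R : realType) (H : hilbertSpace R) (X : topologicalType)
    (A : X -> set (H * H)) (saA : forall x, adjoint (A x) = A x)
    (e : X -> nat -> H) (l : X -> nat -> R) (L : set R)
    (eb : forall x, eigenbasis (A x) L (e x) (l x)) (x0 : X) :
  Riesz_continuous A -> fcont e l x0 (@btr R).
Proof.
move=> cA; have bb := @bdd_btr R; split => // d d0.
apply: filterS (cA x0 d d0) => x.
rewrite !(bounded_transformE (saA _) (eb _)) => h v.
apply: le_trans (ler_wpM2r (rnorm_ge0 v) (ltW h)).
have := @le_opnorm _ _ (fun v => fcalc (e x) (l x) (@btr R) v - fcalc (e x0) (l x0)
  (@btr R) v) (1 + 1).
apply; first by move=> a w; rewrite !(fcalcZ (eb _))// scalerBr.
move=> w; apply: le_trans (rnormB _ _) _; rewrite mulrDl.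
by apply: lerD; apply: (fcalc_bounded (eb _)) (@btr_le1 R) _.
Qed.

Theorem theorem5p4 (R : realType) (H : hilbertSpace R)
    (Hsep : separable H) (Hinf : infinite_dimensional H)
    (X : topologicalType) (A : X -> set (H * H))
    (A_RKsa : forall x, RKsa (A x)) (A_cont : Riesz_continuous A)
    (r : X -> R) (r_cont : continuous r) (r_gt0 : forall x, 0 < r x)
    (P : X -> H -> H) (P_section : spectral_section r A P) :
  exists C : X -> H -> H,
    [/\ trivializing_family r A C, agrees_with A C P &
        forall x, opnorm (C x) < 2 * r x].
Proof.
have saA x : adjoint (A x) = A x by case: (A_RKsa x).
have /choice[e /choice[l eb]] : forall x, exists e l, eigenbasis (A x) setT e l.
  by move=> x; exact: RKsa_eigenbasis.
have /choice[n0 disc] : forall x, exists n0, forall n, (n0 <= n)%N -> e x n != 0 -> r x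
  <= `|l x n|.
  move=> x; have [_ _ [K cK KA]] := A_RKsa x.
  exact: (eigenbasis_discrete (saA x) _ cK KA (eb x)).
have [P_cont P_at] := P_section.
have pP x : orthogonal_projection (P x) by case: (P_at x).
pose C x := trivializer (e x) (l x) (r x) (P x).
have C_at x : trivializing_operator (r x) (A x) (C x).
  split.
  - exact: (trivializer_selfadjoint (saA x) (eb x) (r_gt0 x) (disc x) (P_at x)).
  - exact: (trivializer_finite_rank (saA x) (eb x) (r_gt0 x) (disc x) (P_at x)).
  - exact: (perturbed_invertible (saA x) (eb x) (r_gt0 x) (P_at x) Hsep).
  - exact: (trivializer_range (saA x) (eb x) (r_gt0 x) (P_at x)).
exists C; split.
- split => // x d d0.
  (* The difference [C y - C x] is split into five terms of size at most [d / 8]; the slack in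
     [5 d / 8 < d] makes the estimate strict. The factor [r x + 1] bounds [r y] near [x]. *)
  have rx := r_gt0 x; have d8 : 0 < d / 8 by rewrite divr_gt0.
  have dP : 0 < d / 8 / (r x + 1) by rewrite divr_gt0// addr_gt0.
  have [_ hc] := fcont_clamp eb (r_gt0 x) (fcont_btr saA eb x A_cont).
  have hr : \forall y \near x, `|r x - r y| < Num.min 1 (d / 8).
    by have /cvgrPdist_lt := r_cont x; apply; rewrite lt_min ltr01.
  near=> y.
  apply: (@le_lt_trans _ _ (d / 8 * 5)); last by lra.
  apply: opnorm_le; first by rewrite mulr_ge0// ltW.
  move=> v.
  have : `|r x - r y| < Num.min 1 (d / 8) by near: y.
  rewrite lt_min => /andP[r1 r2].
  have hcy : N (fcalc (e y) (l y) (clamp (r x)) v - fcalc (e x) (l x) (clamp (r x)) v)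
    <= d / 8 * N v.
    by move: v; near: y; exact: hc.
  have hPy : N (P y v - P x v) <= d / 8 / (r x + 1) * N v.
    have hop : opnorm (fun v => P y v - P x v) < d / 8 / (r x + 1).
      by near: y; exact: P_cont.
    apply: le_trans (ler_wpM2r (rnorm_ge0 v) (ltW hop)).
    have := @le_opnorm _ _ (fun v => P y v - P x v) (1 + 1).
    apply; first by move=> a w; rewrite !(projZ (pP _)) scalerBr.
    move=> w; apply: le_trans (rnormB _ _) _; rewrite mulrDl.
    have proj_bounded z : bounded_by (P z) 1.
      by apply: selfadjoint_idem_bounded; [exact: proj_sym | exact: proj_idem].
    by apply: lerD; exact: proj_bounded.
  (* The terms separate the variation of [P], taken twice, the variation of [r] in the reflection
     and in the clamp, and the variation of [A] at the fixed level [r x]. *)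
  have -> : C y v - C x v =
      ((r y)%:C%C *: (P y v - P x v) + (r y)%:C%C *: (P y v - P x v)) +
      (r y - r x)%:C%C *: reflection (P x) v
      - fcalc (e y) (l y) (fun t => clamp (r y) t - clamp (r x) t) v
      - (fcalc (e y) (l y) (clamp (r x)) v - fcalc (e x) (l x) (clamp (r x)) v).
    have -> : fcalc (e y) (l y) (fun t => clamp (r y) t - clamp (r x) t) v =
        fcalc (e y) (l y) (clamp (r y)) v - fcalc (e y) (l y) (clamp (r x)) v.
      apply: (fcalc_uniq (eb y)).
        by exists `|r y - r x| => t; exact: clamp_dist (ltW (r_gt0 y)) (ltW rx).
      move=> n; rewrite ipBl !(fcalcE (eb y)) ?rmorphB ?mulrBl//; exact: bdd_clamp.
    by rewrite /C /trivializer /reflection rmorphB; vec.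
  have h1 : N ((r y)%:C%C *: (P y v - P x v)) <= d / 8 * N v.
    rewrite rnormZR ger0_norm ?(ltW (r_gt0 y))//.
    have ryx : r y <= r x + 1 by move: r1; rewrite ltr_norml; lra.
    apply: le_trans (ler_wpM2r (rnorm_ge0 _) ryx) _.
    rewrite -ler_pdivlMl ?addr_gt0// mulrA (mulrC _^-1).
    by [].
  have h2 : N ((r y - r x)%:C%C *: reflection (P x) v) <= d / 8 * N v.
    rewrite rnormZR (reflection_norm (pP x)) distrC.
    by apply: ler_wpM2r (ltW r2); exact: rnorm_ge0.
  have h3 : N (fcalc (e y) (l y) (fun t => clamp (r y) t - clamp (r x) t) v) <= d / 8 *
    N v.
    have hb t : `|clamp (r y) t - clamp (r x) t| <= d / 8.
      apply: le_trans (clamp_dist _ (ltW (r_gt0 y)) (ltW rx)) _.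
      by rewrite distrC ltW.
    exact: (fcalc_bounded (eb y) hb).
  apply: le_trans (rnormB _ _) _; apply: le_trans (lerD (rnormB _ _) hcy) _.
  apply: le_trans (lerD (lerD (rnormD _ _) h3) (lexx _)) _.
  apply: le_trans (lerD (lerD (lerD (rnormD _ _) h2) (lexx _)) (lexx _)) _.
  have := rnorm_ge0 v; move: h1; move: (N (_ *: _)) (N v) => a b h1 b0.
  have : 0 <= d * b by rewrite mulr_ge0// ltW.
  by move: h1; lra.
- by move=> x; exact: (section_agrees (saA x) (eb x) (r_gt0 x) (P_at x) Hsep).
- move=> x.
  have [s /andP[s0 sr] hs] := trivializer_bound (saA x) (eb x) (r_gt0 x) (disc x) (P_at
    x).
  exact: le_lt_trans (opnorm_le s0 hs) sr.
Unshelve. all: by end_near.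
Qed.
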